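(* Let $0\le i\le k$, $0\le r\le d$ be integers. Let $\mathcal{C}$ be an $i$-dimensional simplicial complex contained in the coordinate subspace $\{x_{i+1}=\cdots=x_k=0\}\subseteq\mathbb{R}^k$ which is the star of the origin $O$ (every maximal simplex contains $O$, and $O$ is its only interior vertex), let $\tau$ be a $(k-i)$-simplex with vertices $v_0=O,v_1,\dots,v_{k-i}$ lying in $\{x_1=\cdots=x_i=0\}$, and let $\mathcal{O}'$ be the simplicial complex whose maximal simplices are $\omega*v_1*\cdots*v_{k-i}$ for the maximal simplices $\omega$ of $\mathcal{C}$ (together with all their faces). For $0\le j\le d$ let $\mathcal{C}_j=(j/d)\,\mathcal{C}$ (with $\mathcal{C}_0=\{O\}$), and let $\mathcal{M}_j$ be a minimal determining set for $S^r_j(\mathcal{C}_j)$ (for $j=0$ this is the single point $O$). Then a minimal determining set for $S^r_d(\mathcal{O}')$ is \[ \mathcal{M}'=\bigcup_{j=0}^{d}\bigl\{\,p+\xi^\tau_{j,j_1,\dots,j_{k-i}}\colon p\in\mathcal{M}_j,\ \xi^\tau_{j,j_1,\dots,j_{k-i}}\in\mathcal{D}^\tau\bigr\}. \] Moreover, \[ \dim S^r_d(\mathcal{O}')=\sum_{j=0}^{d}\binom{d+k-j-i-1}{k-i-1}\,|\mathcal{M}_j|. \]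
   Context: For a simplicial complex $\Delta$, $S^r_d(\Delta)$ is the space of $C^r$-smooth functions on the union of its simplices that are polynomials of degree at most $d$ on each maximal simplex. Bernstein–Bézier form: for an $m$-simplex with vertices $w_0,\dots,w_m$, the degree-$d$ domain points are $\sum_s \ell_s w_s/d$ with nonnegative integers $\sum_s\ell_s=d$; each polynomial of degree $\le d$ on the simplex is uniquely a linear combination of the degree-$d$ Bernstein basis polynomials, whose coefficients are indexed by these domain points. A spline in $S^0_d(\Delta)$ is thus identified with an assignment of coefficients to the set $\mathcal{D}$ of all degree-$d$ domain points of simplices of $\Delta$ (coefficients at shared points coincide). A subset $\mathcal{M}\subseteq\mathcal{D}$ is a determining set for a subspace $S\subseteq S^0_d(\Delta)$ if every $s\in S$ whose coefficients at all points of $\mathcal{M}$ vanish is identically zero; a minimal determining set is one of smallest cardinality (its cardinality equals $\dim S$). Here $\mathcal{D}^\tau=\{\xi^\tau_{j,j_1,\dots,j_{k-i}}=(j_1v_1+\cdots+j_{k-i}v_{k-i})/d\colon j+j_1+\cdots+j_{k-i}=d,\ j,j_s\ge0\}$ denotes the degree-$d$ domain points of $\tau$, with first index $j$ attached to $v_0=O$. Binomial coefficients with lower index $-1$ (case $i=k$) follow the convention $\binom{-1}{-1}=1$, $\binom{m}{-1}=0$ for $m\ge0$. *)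

(* Defs.v *)
From HB Require Import structures.
From mathcomp Require Import all_boot all_order all_algebra finmap.
From mathcomp Require Import all_classical all_reals all_analysis.
From mathcomp Require Import -(notations) mpoly.

Set Implicit Arguments.
Unset Strict Implicit.
Unset Printing Implicit Defensive.

Import Order.TTheory GRing.Theory Num.Theory.
Import numFieldNormedType.Exports.

Local Open Scope classical_set_scope.
Local Open Scope ring_scope.

Section families.
Context {R : realType} {k : nat} {I : finType}.
Implicit Types (v : I -> 'rV[R]_k) (b : I -> R).

Definition affinely_independent v :=
  forall b, \sum_t b t = 0 -> \sum_t b t *: v t = 0 -> forall t, b t = 0.

Definition is_weight b := (forall t, 0 <= b t) /\ \sum_t b t = 1.

(* The empty family has no weights, so its hull is empty. *)
Definition conv_hull v : set 'rV[R]_k :=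
  [set x | exists2 b, is_weight b & x = \sum_t b t *: v t].

(* Multi-indices of total degree d, each entry being at most d. *)
Definition multi_index (d : nat) : pred {ffun I -> 'I_d.+1} :=
  fun l => (\sum_t l t)%N == d.

(* In degree 0 the convention x / 0 = 0 makes the origin the only domain
   point, in accordance with the scaled complex C_0 = {O} below. *)
Definition domain_point d v (l : {ffun I -> 'I_d.+1}) : 'rV[R]_k :=
  d%:R^-1 *: \sum_t (l t)%:R *: v t.

(* Bernstein polynomial, as a function of the barycentric coordinates. *)
Definition bernstein d (l : {ffun I -> 'I_d.+1}) b : R :=
  (d`!)%:R / (\prod_t (l t)`!)%:R * \prod_t b t ^+ l t.

End families.
Arguments multi_index I d : clear implicits.

Section complexes.
Context {R : realType} {k : nat}.
Local Notation E := 'rV[R]_k.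
(* A simplex is encoded by its set of vertices. *)
Implicit Types (s : {fset E}) (K : set {fset E}).

Definition vertices s : s -> E := fun w => val w.

Record simplicial_complex K : Prop := SimplicialComplex {
  complex_finite : finite_set K;
  complex_nonempty : forall s, K s -> s != fset0;
  complex_affine : forall s, K s -> affinely_independent (@vertices s);
  complex_face : forall s s', K s -> s' != fset0 -> (s' `<=` s)%fset -> K s';
  complex_cap : forall s s', K s -> K s' ->
    conv_hull (@vertices s) `&` conv_hull (@vertices s') =
    conv_hull (@vertices (s `&` s')%fset) }.

Definition maximal_simplex K s :=
  K s /\ forall s', K s' -> (s `<=` s')%fset -> s' = s.

Definition complex_dim K (n : nat) :=
  (exists2 s, K s & #|` s| = n.+1) /\ forall s, K s -> (#|` s| <= n.+1)%N.

Definition polyhedron K : set E := \bigcup_(s in K) conv_hull (@vertices s).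

(* w is a vertex of K and the polyhedron of K is a neighbourhood of w in H. *)
Definition interior_vertex (H : set E) K (w : E) :=
  K [fset w]%fset /\ within H (nbhs w) (polyhedron K).

Definition star_of_origin (H : set E) K :=
  (forall s, maximal_simplex K s -> 0 \in s) /\
  (forall w, interior_vertex H K w <-> w = 0).

(* For a = 0 and K nonempty this is the complex reduced to the origin. *)
Definition scale_complex (a : R) K : set {fset E} :=
  [set [fset a *: w | w in s]%fset | s in K].

(* All the nonempty faces of the joins w * V, for w a maximal simplex of K. *)
Definition join_complex K (V : {fset E}) : set {fset E} :=
  [set s | s != fset0 /\
     exists2 w, maximal_simplex K w & (s `<=` w `|` V)%fset].

Definition domain_points K (d : nat) : set E :=
  \bigcup_(s in K)
    [set domain_point (@vertices s) l | l in [set l | multi_index s d l]].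

End complexes.

Section splines.
Context {R : realType} {k : nat}.
Local Notation E := 'rV[R]_k.

Fixpoint Cr_function (r : nat) (g : E -> R) : Prop :=
  continuous g /\
  if r is r'.+1 then
    forall t : 'I_k, (forall x, derivable g x (delta_mx 0 t)) /\
      Cr_function r' (fun x => 'D_(delta_mx 0 t) g x)
  else True.

(* A function on a (closed) subset of R^k is C^r when it is the restriction of
   a C^r function on R^k.  This is independent of the ambient space, hence also
   suits complexes that are not full-dimensional. *)
Definition Cr_on (A : set E) (r : nat) (f : A -> R) : Prop :=
  exists2 g : E -> R, Cr_function r g & forall x : A, f x = g (val x).

(* msize is the total degree plus one (and 0 for the zero polynomial). *)
Definition poly_on (A B : set E) (d : nat) (f : A -> R) : Prop :=
  exists2 p : mpoly k R, (msize p <= d.+1)%N &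
    forall x : A, B (val x) -> f x = meval (fun t => val x 0 t) p.

Implicit Types (K : set {fset E}) (M : set E).

Definition spline_space K (r d : nat) : set (polyhedron K -> R) :=
  [set f | Cr_on r f /\ forall s, maximal_simplex K s ->
                          poly_on (conv_hull (@vertices R k s)) d f].

(* c gives the Bernstein-Bezier coefficients of f; only its values at the
   degree-d domain points of K matter. *)
Definition BB_coefficients K (d : nat) (f : polyhedron K -> R) (c : E -> R) :=
  forall s, maximal_simplex K s -> forall b : s -> R, is_weight b ->
  forall x : polyhedron K, val x = \sum_w b w *: vertices w ->
  f x = \sum_(l | multi_index s d l)
          c (domain_point (@vertices R k s) l) * bernstein l b.

Definition determining_set K (d : nat) (S : set (polyhedron K -> R)) M :=
  M `<=` domain_points K d /\
  forall f c, S f -> BB_coefficients d f c -> (forall p, M p -> c p = 0) ->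
  forall x, f x = 0.

Definition minimal_determining_set K (d : nat) (S : set (polyhedron K -> R)) M :=
  determining_set d S M /\ forall N, determining_set d S N -> (M #<= N)%card.

End splines.
Arguments spline_space {R k} K r d _.

Definition has_dim {R : realType} {T : Type} (S : set (T -> R)) (n : nat) :=
  exists e : 'I_n -> T -> R,
    [/\ forall t, S (e t),
        forall c : 'I_n -> R,
          (forall x, \sum_t c t * e t x = 0) -> forall t, c t = 0 &
        forall f, S f ->
          exists c : 'I_n -> R, forall x, f x = \sum_t c t * e t x].

(* Binomial coefficient with binom(-1,-1) = 1 and binom(m,-1) = 0 for m >= 0;
   the remaining values at negative arguments are irrelevant. *)
Definition binz (m n : int) : nat :=
  match m, n with
  | Posz m, Posz n => 'C(m, n)
  | Negz 0, Negz 0 => 1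
  | _, _ => 0
  end.

(* Main.v *)
(** A spline on a complex is encoded by a function c on the domain points; it is
    admissible when some C^r function g on R^k has, on every maximal simplex, the
    Bernstein form with coefficients c.  Write m = k - i, let y_1, ..., y_m be the
    barycentric coordinates of v_1, ..., v_m and u = 1 - y_1 - ... - y_m.  On
    w * v_1 * ... * v_m a Bernstein form of degree d splits as the sum over J of
    multinomial * y^J * H_J, where H_J is the form of degree j = d - |J| on w with
    the coefficients c (. + xi_J).  So it suffices to see that c is admissible for
    O' iff every c (. + xi_J) is admissible for C_j.

    If g extends the spline, then by homogeneity the sum over J of
    multinomial * y^J * H_J equals (1 + |y|)^d g ((x + sum_t y_t v_t) / (1 + |y|))
    for all y >= 0, and H_J (x) is a fixed linear combination of the values at a
    grid of points y.  Conversely, since every maximal simplex contains O, H_J at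
    mass u is an interpolation polynomial in u with values a^j g_J (x / a) at the
    integers a >= 1, and this is C^r in the point.

    The coefficient space of O' is thus a direct sum of those of the C_j.  A
    minimal determining set has a dual family of coefficient functions, these
    extend to a dual family for M', and a determining set with a dual family is
    minimal, its cardinality being the dimension. *)

Require Import Defs.
From HB Require Import structures.
From mathcomp Require Import all_boot all_order all_algebra finmap.
From mathcomp Require Import all_classical all_reals all_analysis.
From mathcomp Require Import -(notations) mpoly.
From mathcomp Require Import ring.
Import Order.TTheory GRing.Theory Num.Theory.
Import numFieldNormedType.Exports.

Set Implicit Arguments.
Unset Strict Implicit.

Local Open Scope classical_set_scope.
Local Open Scope ring_scope.

(** * Closure properties of C^r functions on R^k *)

Section smooth_functions.
Context {R : realType} {k : nat}.
Implicit Types (f g : 'rV[R]_k -> R) (r : nat).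

Lemma Cr_continuous r f : Cr_function r f -> continuous f.
Proof. by case: r => [|r] []. Qed.

Lemma Cr_pred r f : Cr_function r.+1 f -> Cr_function r f.
Proof.
elim: r f => [|r IHr] f [cf df]; first by split.
by split=> // t; have [dft /IHr Cft] := df t.
Qed.

Lemma Cr_ext r f g : f =1 g -> Cr_function r f -> Cr_function r g.
Proof. by move=> /funext->. Qed.

Lemma Cr_cst r (a : R) : Cr_function r (fun _ : 'rV[R]_k => a).
Proof.
elim: r a => [|r IHr] a /=; first by split; [move=> x; exact: cst_continuous|].
split; first by move=> x; exact: cst_continuous.
move=> t; split=> [x|]; first exact: derivable_cst.
by apply: (@Cr_ext _ (fun=> 0)) => // x; rewrite derive_cst.
Qed.

Lemma Cr_add r f g :
  Cr_function r f -> Cr_function r g -> Cr_function r (fun x => f x + g x).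
Proof.
elim: r f g => [|r IHr] f g [cf df] [cg dg]; split=> //; do ?
  by move=> x; apply: continuousD; [exact: cf|exact: cg].
move=> t; have [dft Cft] := df t; have [dgt Cgt] := dg t; split=> [x|].
  exact: derivableD.
apply: Cr_ext (IHr _ _ Cft Cgt) => x.
by rewrite -deriveD.
Qed.

Lemma Cr_mul r f g :
  Cr_function r f -> Cr_function r g -> Cr_function r (fun x => f x * g x).
Proof.
elim: r f g => [|r IHr] f g Cf Cg.
  split=> // x; apply: continuousM; exact: (Cr_continuous (r := 0)).
have [cf df] := Cf; have [cg dg] := Cg; split.
  by move=> x; apply: continuousM; [exact: cf|exact: cg].
move=> t; have [dft Cft] := df t; have [dgt Cgt] := dg t; split=> [x|].
  exact: derivableM.
have Cfg := Cr_add (IHr _ _ (Cr_pred Cf) Cgt) (IHr _ _ (Cr_pred Cg) Cft).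
apply: Cr_ext Cfg => x.
by rewrite [RHS]deriveM.
Qed.

Lemma Cr_scale r (a : R) f : Cr_function r f -> Cr_function r (fun x => a * f x).
Proof. by move=> Cf; apply: Cr_mul => //; exact: Cr_cst. Qed.

Lemma Cr_sum r (I : Type) (s : seq I) (P : pred I) (F : I -> 'rV[R]_k -> R) :
  (forall i, P i -> Cr_function r (F i)) ->
  Cr_function r (fun x => \sum_(i <- s | P i) F i x).
Proof.
move=> CF; elim: s => [|i s IHs].
  by apply: (@Cr_ext _ (fun=> 0)) (Cr_cst _ _) => x; rewrite big_nil.
case Pi: (P i); last by apply: Cr_ext IHs => x; rewrite big_cons Pi.
by apply: Cr_ext (Cr_add (CF i Pi) IHs) => x; rewrite big_cons Pi.
Qed.

Lemma Cr_exp r n f : Cr_function r f -> Cr_function r (fun x => f x ^+ n).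
Proof.
move=> Cf; elim: n => [|n IHn]; first exact: Cr_cst.
by apply: Cr_ext (Cr_mul Cf IHn) => x; rewrite exprS.
Qed.

Lemma Cr_prod r (I : Type) (s : seq I) (F : I -> 'rV[R]_k -> R) :
  (forall i, Cr_function r (F i)) ->
  Cr_function r (fun x => \prod_(i <- s) F i x).
Proof.
move=> CF; elim: s => [|i s IHs].
  by apply: (@Cr_ext _ (fun=> 1)) (Cr_cst _ _) => x; rewrite big_nil.
by apply: Cr_ext (Cr_mul (CF i) IHs) => x; rewrite big_cons.
Qed.

Lemma diag_affine_shift (a b x : 'rV[R]_k) (h : R) (t : 'I_k) :
  (\row_u (a 0 u * (h *: delta_mx 0 t + x) 0 u) + b : 'rV[R]_k) =
  h *: (a 0 t *: delta_mx 0 t) + (\row_u (a 0 u * x 0 u) + b).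
Proof.
apply/rowP => u; rewrite !mxE eqxx /=.
case: (u =P t) => [->|_]; first by rewrite /= !mulr1 mulrDr [a 0 t * h]mulrC addrA.
by rewrite /= !mulr0 !add0r.
Qed.

Lemma diag_affine_continuous (a b : 'rV[R]_k) :
  continuous (fun x : 'rV[R]_k => \row_u (a 0 u * x 0 u) + b : 'rV[R]_k).
Proof.
move=> x.
have -> : (fun x : 'rV[R]_k => \row_u (a 0 u * x 0 u) + b : 'rV[R]_k) =
          (fun x => \sum_u (a 0 u * x 0 u) *: delta_mx 0 u + b).
  apply/funext => y; congr (_ + b); rewrite [LHS]row_sum_delta.
  by apply: eq_bigr => u _; rewrite mxE.
apply: continuousD; last exact: cst_continuous.
have -> : (fun x : 'rV[R]_k => \sum_u (a 0 u * x 0 u) *: 'e_u : 'rV[R]_k) =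
          \sum_u (fun x : 'rV[R]_k => (a 0 u * x 0 u) *: 'e_u : 'rV[R]_k).
  by apply/funext => y; rewrite fct_sumE.
elim/big_ind : _ => [|f g cf cg|u _]; [exact: cst_continuous|exact: continuousD|].
apply: continuousZr_tmp; apply: continuousM; first exact: cst_continuous.
exact: coord_continuous.
Qed.

(** Justifies substituting h a for h in a difference quotient: multiplication by a is continuous at
    0 and keeps nonzero h nonzero. *)
Lemma cvg_dnbhs0_mulr (a : R) : a != 0 -> (h * a @[h --> 0^'] --> 0^').
Proof.
move=> a0 A /= A0.
have : (fun h : R => h * a) @ nbhs 0 --> (0 * a : R).
  by apply: cvgM; [exact: cvg_id|exact: cvg_cst].
rewrite mul0r => /(_ _ A0) hA.
have {}hA : \forall h \near (0 : R), h * a != 0 -> A (h * a) by [].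
change (\forall h \near (0 : R), h != 0 -> A (h * a)).
apply: filterS hA => h hA h0; apply: hA.
by rewrite mulf_neq0.
Qed.

(** The difference quotient in direction a w at step h is a times the one in direction w at step h
    a. *)
Lemma is_derive_scale_dir (f : 'rV[R]_k -> R) (x w : 'rV[R]_k) (a : R) :
  derivable f x w -> is_derive x (a *: w) f (a * 'D_w f x).
Proof.
move=> dfx; have [->|a0] := eqVneq a 0.
  by rewrite scale0r mul0r; exact: is_derive0.
have lim_f : h^-1 *: ((f \o shift x) (h *: (a *: w)) - f x) @[h --> 0^']
             --> a * 'D_w f x.
  have -> : (fun h : R => h^-1 *: ((f \o shift x) (h *: (a *: w)) - f x)) =
      (fun h : R => a * ((h * a)^-1 *: ((f \o shift x) ((h * a) *: w) - f x))).
    have scE (u z : R) : u *: z = u * z by [].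
    apply/funext => h; rewrite scalerA !scE mulrA.
    by rewrite invfM [_^-1 / _]mulrC mulVKf.
  apply: cvgM; first exact: cvg_cst.
  exact: (cvg_comp _ _ (cvg_dnbhs0_mulr a0) dfx).
by split; [apply/cvg_ex; exists (a * 'D_w f x)|exact: cvg_lim lim_f].
Qed.

(* Only coordinatewise affine maps are composed, so the chain rule reduces to a
   rescaling of partial derivatives. *)
Lemma Cr_diag_affine r (a b : 'rV[R]_k) f : Cr_function r f ->
  Cr_function r (fun x => f (\row_u (a 0 u * x 0 u) + b)).
Proof.
elim: r f => [|r IHr] f [cf df].
  split=> // x; apply: continuous_comp; first exact: diag_affine_continuous.
  exact: cf.
split.
  move=> x; apply: continuous_comp; first exact: diag_affine_continuous.
  exact: cf.
move=> t; have [dft Cft] := df t.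
set L := fun x : 'rV[R]_k => \row_u (a 0 u * x 0 u) + b : 'rV[R]_k.
(* [L] turns a step h along coordinate t into a step h a_t along the same coordinate, so only the
   partial derivative in direction t enters. *)
have dL x : is_derive x (delta_mx 0 t) (f \o L) (a 0 t * 'D_(delta_mx 0 t) f (L x)).
  have [] := is_derive_scale_dir (a 0 t) (dft (L x)).
  have E : (fun h : R => h^-1 *: ((f \o L \o shift x) (h *: delta_mx 0 t) - (f \o L) x)) =
    (fun h => h^-1 *: ((f \o shift (L x)) (h *: (a 0 t *: delta_mx 0 t)) - f (L x))).
    by apply/funext => h /=; rewrite /L diag_affine_shift.
  by move=> d1 d2; split; rewrite /derivable /derive E.
split=> [x|]; first by have [] := dL x.
apply: Cr_ext (Cr_scale (a 0 t) (IHr _ Cft)) => x.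
by have [] := dL x.
Qed.

Lemma Cr_coord r (t : 'I_k) : Cr_function r (fun x : 'rV[R]_k => x 0 t).
Proof.
case: r => [|r]; first by split=> //; exact: coord_continuous.
split; first exact: coord_continuous.
move=> u.
have dc (x : 'rV[R]_k) : is_derive x (delta_mx 0 u : 'rV[R]_k) (fun x : 'rV[R]_k => x 0 t) ((t == u)%:R).
  have lim_c : (fun h : R => h^-1 *: (((fun x : 'rV[R]_k => x 0 t) \o shift x) (h *: delta_mx 0 u) - x 0 t))
     @ 0^' --> ((t == u)%:R : R).
    apply: cvg_near_cst; near=> h => /=.
    rewrite !mxE eqxx /= addrK scalerA mulVf ?scale1r //.
    by near: h; exact: nbhs_dnbhs_neq.
  by split; [apply/cvg_ex; eexists; exact: lim_c|exact: cvg_lim lim_c].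
split=> [x|]; first by have [] := dc x.
by apply: Cr_ext (Cr_cst _ (t == u)%:R) => x; have [] := dc x.
Unshelve. all: by end_near. Qed.

End smooth_functions.

(** * Transfer of sums and families along an injection of index types *)

Section extension_by_zero.
Context {I J : finType}.

Lemma big_inj_codom (T : Type) (idx : T) (op : Monoid.com_law idx)
    (h : I -> J) (F : J -> T) :
  injective h -> (forall t', (forall t, h t != t') -> F t' = idx) ->
  \big[op/idx]_t' F t' = \big[op/idx]_t F (h t).
Proof.
move=> injh F0; rewrite (bigID (fun t' => t' \in h @: [set: I])%SET) /=.
rewrite [X in op _ X]big1 ?Monoid.mulm1; last first.
  move=> t' t'h; apply: F0 => t; apply: contraNneq t'h => <-.
  exact: imset_f.
rewrite big_imset /=; last by move=> x y _ _ /injh.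
by apply: eq_bigl => t; rewrite inE.
Qed.

(** Push-forward along a face inclusion: with [z] equal to 0 it turns multi-indices and weights of a
    face into those of the larger simplex. *)
Definition extend (T : Type) (z : T) (h : I -> J) (l : I -> T) (t' : J) : T :=
  if [pick t | h t == t'] is Some t then l t else z.

Lemma extendE (T : Type) (z : T) (h : I -> J) (l : I -> T) t :
  injective h -> extend z h l (h t) = l t.
Proof.
move=> injh; rewrite /extend; case: pickP => [u /eqP /injh -> //|/(_ t)].
by rewrite eqxx.
Qed.

Lemma extend_out (T : Type) (z : T) (h : I -> J) (l : I -> T) t' :
  (forall t, h t != t') -> extend z h l t' = z.
Proof.
by move=> ht'; rewrite /extend; case: pickP => // t; rewrite (negPf (ht' t)).
Qed.

End extension_by_zero.

(** * Bernstein forms: restriction to faces, splitting, uniqueness, and conversion of polynomials *)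

Definition sum_fun {I K : Type} {T : Type} (a : I -> T) (b : K -> T)
  (x : I + K) : T := match x with inl i => a i | inr j => b j end.

Section bernstein_forms.
Context {R : realType}.

(* Forms of degree n in Bernstein normalisation. The bound N on the entries of
   the multi-indices is immaterial as soon as n <= N; it lets forms of different
   degrees share one finite index type. *)
Definition bform (I : finType) (N n : nat) (a : (I -> nat) -> R) (b : I -> R) : R :=
  \sum_(l : {ffun I -> 'I_N.+1} | (\sum_t l t)%N == n)
     a (fun t => l t) *
     ((n`!)%:R / (\prod_t (l t)`!)%:R * \prod_t b t ^+ l t).

(** Restriction to a face: [b] vanishes off the image of [h], so every multi-index with a positive
    entry there contributes 0. *)
Lemma bform_inj (I J : finType) (h : I -> J) N n a b : injective h ->
  (forall t', (forall t, h t != t') -> b t' = 0) ->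
  bform N n a b = bform N n (fun l => a (extend 0%N h l)) (fun t => b (h t)).
Proof.
move=> injh b0; rewrite /bform big_mkcond [RHS]big_mkcond /=.
pose E (l : {ffun I -> 'I_N.+1}) := [ffun t' => extend ord0 h l t'].
have Eh l t : E l (h t) = l t by rewrite ffunE extendE.
have Eo l t' : (forall t, h t != t') -> E l t' = ord0.
  by move=> ht'; rewrite ffunE extend_out.
rewrite (@big_inj_codom _ _ _ _ _ E) => [|l l' /ffunP ll'|l' l'E]; last 2 first.
- by apply/ffunP => t; rewrite -!Eh ll'.
- case: ifP => // _.
  (* Either [l'] has a positive entry off the image of [h], and its monomial vanishes, or it is the
     extension of its restriction, against the choice of [l']. *)
  have [/existsP[t' /andP[/forallP ht' lt']]|l'0] :=
    boolP [exists t', [forall t, h t != t'] && (l' t' != ord0)].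
    rewrite [\prod_t b t ^+ _](bigD1 t') //= b0 // expr0n.
    move: lt'; rewrite -val_eqE /= => /negPf ->.
    by rewrite !(mul0r, mulr0).
  case/eqP: (l'E [ffun t => l' (h t)]); apply/ffunP => t'.
  rewrite ffunE /extend; case: pickP => [t /eqP <-|ht']; first by rewrite ffunE.
  move: l'0; rewrite negb_exists => /forallP /(_ t').
  rewrite negb_and negbK => /orP[/negP[]|/eqP ->//].
  by apply/forallP => t; rewrite ht'.
apply: eq_bigr => l _.
have sE : (\sum_t' E l t')%N = (\sum_t l t)%N.
  rewrite (@big_inj_codom _ _ _ _ _ h) //; last by move=> t' /Eo ->.
  by apply: eq_bigr => t _; rewrite Eh.
have pE : (\prod_t' (E l t')`!)%N = (\prod_t (l t)`!)%N.
  rewrite (@big_inj_codom _ _ _ _ _ h) //; last by move=> t' /Eo ->.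
  by apply: eq_bigr => t _; rewrite Eh.
have bE : \prod_t' b t' ^+ E l t' = \prod_t b (h t) ^+ l t.
  rewrite (@big_inj_codom _ _ _ _ _ h) //; last by move=> t' /Eo ->.
  by apply: eq_bigr => t _; rewrite Eh.
rewrite sE pE bE.
have -> // : (fun t' => nat_of_ord (E l t')) = extend 0%N h (fun t => l t).
by apply/funext => t'; rewrite ffunE /extend; case: pickP.
Qed.

Lemma leq_sum_entry (I : finType) (l : I -> nat) t : (l t <= \sum_t l t)%N.
Proof. by rewrite (bigD1 t) //= leq_addr. Qed.

(** No entry of a multi-index of total n exceeds n, so a larger bound adds no term. *)
Lemma bform_bound (I : finType) N n a (b : I -> R) : (n <= N)%N ->
  bform N n a b = bform n n a b.
Proof.
move=> nN; rewrite /bform big_mkcond [RHS]big_mkcond /=.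
pose E (l : {ffun I -> 'I_n.+1}) : {ffun I -> 'I_N.+1} :=
  [ffun t => widen_ord (nN : (n.+1 <= N.+1)%N) (l t)].
have EE l t : E l t = l t :> nat by rewrite ffunE.
rewrite (@big_inj_codom _ _ _ _ _ E) => [|l l' /ffunP ll'|l' l'E]; last 2 first.
- by apply/ffunP => t; apply: val_inj; rewrite /= -!EE ll'.
- case: ifP => // /eqP sl'.
  case/eqP: (l'E [ffun t => inord (l' t)]); apply/ffunP => t; apply: val_inj.
  rewrite /= EE ffunE inordK // ltnS -sl'.
  exact: (leq_sum_entry (fun t => nat_of_ord (l' t))).
apply: eq_bigr => l _.
have sE : (\sum_t E l t)%N = (\sum_t l t)%N by apply: eq_bigr.
have pE : (\prod_t (E l t)`!)%N = (\prod_t (l t)`!)%N.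
  by apply: eq_bigr => t _; rewrite EE.
have bE : \prod_t b t ^+ E l t = \prod_t b t ^+ l t.
  by apply: eq_bigr => t _; rewrite EE.
rewrite sE pE bE.
have -> // : (fun t => nat_of_ord (E l t)) = (fun t => nat_of_ord (l t)).
by apply/funext => t.
Qed.

(** The multinomial coefficient of a pair (l, j) factors as N! / ((N - |j|)! j!) times the
    coefficient (N - |j|)! / l! of a form in the first group of variables. *)
Lemma bform_split (I K : finType) N a (b : I + K -> R) :
  bform N N a b =
  \sum_(j : {ffun K -> 'I_N.+1} | (\sum_t j t <= N)%N)
    (N`!)%:R / (((N - \sum_t j t)`!)%:R * (\prod_t (j t)`!)%:R) *
    (\prod_t b (inr t) ^+ j t) *
    bform N (N - \sum_t j t) (fun l => a (sum_fun l (fun t => j t)))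
      (fun t => b (inl t)).
Proof.
pose E (p : {ffun K -> 'I_N.+1} * {ffun I -> 'I_N.+1}) : {ffun I + K -> 'I_N.+1} :=
  [ffun x => sum_fun p.2 p.1 x].
have bijE : bijective E.
  exists (fun l : {ffun I + K -> 'I_N.+1} => ([ffun t => l (inr t)], [ffun t => l (inl t)])) => [[x y]|l] /=.
    by congr pair; apply/ffunP => t; rewrite !ffunE.
  by apply/ffunP => -[t|t]; rewrite !ffunE /= ffunE.
rewrite [LHS]/bform (reindex E) /=; last exact: onW_bij.
pose G j l := if (\sum_t E (j, l) t)%N == N then a (fun t => E (j, l) t) *
  ((N`!)%:R / (\prod_t (E (j, l) t)`!)%:R * \prod_t b t ^+ E (j, l) t) else 0.
rewrite big_mkcond (eq_bigr (fun p => G p.1 p.2)); last by case.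
rewrite -(pair_bigA _ G) /G {G} /=.
rewrite [RHS]big_mkcond; apply: eq_bigr => j _.
have sE l : (\sum_t E (j, l) t = \sum_t l t + \sum_t j t)%N.
  by rewrite big_sumType /=; congr addn; apply: eq_bigr => t _; rewrite ffunE.
have pE l : (\prod_t (E (j, l) t)`! = (\prod_t (l t)`!) * \prod_t (j t)`!)%N.
  by rewrite big_sumType /=; congr muln; apply: eq_bigr => t _; rewrite ffunE.
have bE l : \prod_t b t ^+ E (j, l) t =
    (\prod_t b (inl t) ^+ l t) * \prod_t b (inr t) ^+ j t.
  by rewrite big_sumType /=; congr (_ * _); apply: eq_bigr => t _; rewrite ffunE.
have aE l : (fun t => nat_of_ord (E (j, l) t)) = sum_fun (fun t => nat_of_ord (l t)) (fun t => nat_of_ord (j t)).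
  by apply/funext => -[t|t]; rewrite ffunE.
case: leqP => jN; last first.
  rewrite big1 // => l _; rewrite sE; case: eqP => // H.
  by have := leq_addl (\sum_t l t)%N (\sum_t j t)%N; rewrite H leqNgt jN.
rewrite /bform mulr_sumr [RHS]big_mkcond; apply: eq_bigr => l _.
rewrite sE pE bE aE -(eqn_add2r (\sum_t j t)%N (\sum_t l t)%N) subnK //.
case: eqP => // _.
have fN0 m : (m`!)%:R != 0 :> R by rewrite pnatr_eq0 -lt0n fact_gt0.
have pN0 (L : finType) (u : L -> nat) : (\prod_t (u t)`!)%:R != 0 :> R.
  by rewrite pnatr_eq0 -lt0n prodn_gt0 // => t; exact: fact_gt0.
rewrite natrM.
move: (fN0 (N - \sum_t j t)%N) (pN0 _ (fun t => nat_of_ord (l t)))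
  (pN0 _ (fun t => nat_of_ord (j t))).
move: (a _) ((N - \sum_t j t)`!%:R : R) (N`!%:R : R) ((\prod_t (l t)`!)%:R : R)
  ((\prod_t (j t)`!)%:R : R) (\prod_t b (inl t) ^+ l t) (\prod_t b (inr t) ^+ j t).
move=> A x1 x2 x3 x4 x5 x6 x1N0 x3N0 x4N0; field.
by rewrite x1N0 x3N0 x4N0.
Qed.

(** [mu n] is column n of the inverse of the Vandermonde matrix with nodes 1, ..., N + 1: it
    recovers the coefficient of degree n of a polynomial of degree at most N from its values there.
    All nodes are positive, which later allows division by the mass of a grid point. *)
Lemma vandermonde_dual (N : nat) :
  exists mu : 'I_N.+1 -> 'I_N.+1 -> R, forall n n' : 'I_N.+1,
    \sum_y mu n y * (y.+1)%:R ^+ n' = (n == n')%:R.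
Proof.
pose V : 'M[R]_N.+1 := Vandermonde N.+1 (\row_y (y.+1)%:R).
have Vu : V \in unitmx.
  rewrite unitmxE det_Vandermonde unitfE; apply/prodf_neq0 => i _.
  apply/prodf_neq0 => j ij; rewrite !mxE subr_eq0 eqr_nat eqSS.
  by rewrite gtn_eqF.
exists (fun n y => invmx V y n) => n n'.
have /matrixP /(_ n' n) := mulmxV Vu; rewrite !mxE eq_sym => <-.
by apply: eq_bigr => y _; rewrite !mxE mulrC.
Qed.

(** The product over the variables of one-variable functionals reads off one coefficient of a
    polynomial in several variables. *)
Lemma grid_dual (K : finType) N (j0 : {ffun K -> 'I_N.+1}) :
  exists lam : {ffun K -> 'I_N.+1} -> R, forall j : {ffun K -> 'I_N.+1},
    \sum_y lam y * \prod_t (y t).+1%:R ^+ j t = (j == j0)%:R.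
Proof.
have [mu muP] := vandermonde_dual N.
exists (fun y => \prod_t mu (j0 t) (y t)) => j.
under eq_bigr do rewrite -big_split /=.
rewrite -(bigA_distr_bigA (fun t y => mu (j0 t) y * (y.+1)%:R ^+ j t)) /=.
rewrite (eq_bigr (fun t => (j0 t == j t)%:R)); last by move=> t _; rewrite muP.
case: (j =P j0) => [->|jj0]; first by rewrite big1 // => t _; rewrite eqxx.
have [/existsP[t /negPf jt]|] := boolP [exists t, j0 t != j t].
  by rewrite (bigD1 t) //= jt mul0r.
rewrite negb_exists => /forallP H; case: jj0; apply/ffunP => t.
by apply/eqP; rewrite eq_sym -[_ == _]negbK.
Qed.

Lemma bform_scale (I : finType) N n a (b : I -> R) s :
  bform N n a (fun t => s * b t) = s ^+ n * bform N n a b.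
Proof.
rewrite /bform mulr_sumr; apply: eq_bigr => l /eqP sl.
rewrite (eq_bigr (fun t => s ^+ l t * b t ^+ l t)); last first.
  by move=> t _; rewrite exprMn.
by rewrite big_split /= prodrXr sl; ring.
Qed.

Lemma bformB (I : finType) N n a a' (b : I -> R) :
  bform N n (fun l => a l - a' l) b = bform N n a b - bform N n a' b.
Proof. by rewrite /bform -sumrB; apply: eq_bigr => l _; rewrite mulrBl. Qed.

Lemma bform_deg0 (I : finType) N a (b : I -> R) : bform N 0 a b = a (fun=> 0%N).
Proof.
rewrite /bform (big_pred1 [ffun=> ord0]) => [|l]; last first.
  rewrite sum_nat_eq0; apply/forallP/eqP => [l0|-> t]; last by rewrite ffunE.
  by apply/ffunP => t; rewrite ffunE; apply/val_inj/eqP; exact: l0.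
rewrite !big1 ?divr1 ?mulr1 /=; last 2 first.
- by move=> t _; rewrite ffunE.
- by move=> t _; rewrite ffunE.
by congr a; apply/funext => t; rewrite ffunE.
Qed.

(** By homogeneity the form also vanishes on the positive grid; the functional dual to [l0] then
    isolates the coefficient of [l0] up to a nonzero multinomial factor. *)
Lemma bform_eq0 (I : finType) (t0 : I) N n a :
  (forall b : I -> R, is_weight b -> bform N n a b = 0) ->
  forall l : {ffun I -> 'I_N.+1}, (\sum_t l t)%N = n -> a (fun t => l t) = 0.
Proof.
move=> a0 l0 sl0; have [lam lamP] := grid_dual l0.
(* Dividing the grid point by its mass [s] gives a weight; [t0] ensures that [s] is positive. *)
have grid0 (y : {ffun I -> 'I_N.+1}) : bform N n a (fun t => (y t).+1%:R) = 0.
  pose s : R := \sum_t (y t).+1%:R.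
  have s0 : 0 < s.
    rewrite /s (bigD1 t0) //=; apply: ltr_pwDl; first by rewrite ltr0n.
    by apply: sumr_ge0 => t _; rewrite ler0n.
  have /a0 : is_weight (fun t => s^-1 * (y t).+1%:R).
    split=> [t|]; first by rewrite mulr_ge0 ?ler0n // invr_ge0 ltW.
    by rewrite -mulr_sumr mulVf // gt_eqF.
  rewrite bform_scale => /eqP; rewrite mulf_eq0 expf_eq0 invr_eq0 (gt_eqF s0) andbF.
  by move=> /eqP.
have : \sum_y lam y * bform N n a (fun t => (y t).+1%:R) = 0.
  by rewrite big1 // => y _; rewrite grid0 mulr0.
rewrite /bform; under eq_bigr do rewrite mulr_sumr.
rewrite exchange_big /=.
under eq_bigr => l _ do under eq_bigr => y _ do rewrite [lam y * _]mulrCA [lam y * _]mulrCA.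
under eq_bigr do rewrite -mulr_sumr -mulr_sumr lamP.
rewrite (bigD1 l0) /=; last by rewrite sl0.
rewrite [X in _ + X]big1 ?addr0; last by move=> l /andP[_ /negPf ->]; rewrite !mulr0.
rewrite eqxx mulr1 => /eqP; rewrite mulf_eq0 => /orP[/eqP //|]; apply: contraTeq => _.
rewrite mulf_neq0 ?invr_eq0 ?pnatr_eq0 -?lt0n ?fact_gt0 //.
by rewrite prodn_gt0 // => t; exact: fact_gt0.
Qed.

Lemma bform_ext (I : finType) N n (a a' : (I -> nat) -> R) b :
  (forall l : {ffun I -> 'I_N.+1}, (\sum_t l t)%N = n ->
     a (fun t => l t) = a' (fun t => l t)) -> bform N n a b = bform N n a' b.
Proof. by move=> aa'; apply: eq_bigr => l /eqP /aa' ->. Qed.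

Lemma bform_unique (I : finType) (t0 : I) N n a a' :
  (forall b : I -> R, is_weight b -> bform N n a b = bform N n a' b) ->
  forall l : {ffun I -> 'I_N.+1}, (\sum_t l t)%N = n ->
  a (fun t => l t) = a' (fun t => l t).
Proof.
move=> aa' l sl; apply/eqP; rewrite -subr_eq0; apply/eqP.
apply: (bform_eq0 t0 (a := fun l => a l - a' l)) sl => b bw.
by rewrite bformB aa' // subrr.
Qed.

(** Only the factor belonging to [t0] depends on z, and its exponent is at most n. *)
Lemma bform_poly (I : finType) N n a (b : I -> R) (t0 : I) :
  exists2 p : {poly R}, (size p <= n.+1)%N &
    forall z, p.[z] = bform N n a (fun t => if t == t0 then z + b t else b t).
Proof.
exists (\sum_(l : {ffun I -> 'I_N.+1} | (\sum_t l t)%N == n)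
   (a (fun t => l t) * ((n`!)%:R / (\prod_t (l t)`!)%:R *
     \prod_(t | t != t0) b t ^+ l t)) *: ('X + (b t0)%:P) ^+ l t0).
  apply: (leq_trans (size_sum _ _ _)); apply/bigmax_leqP => l /eqP sl.
  apply: (leq_trans (size_scale_leq _ _)).
  rewrite -[(b t0)%:P]opprK -polyCN size_exp_XsubC ltnS -sl.
  exact: leq_sum_entry.
move=> z; rewrite horner_sum; apply: eq_bigr => l _.
have pE : \prod_t (if t == t0 then z + b t else b t) ^+ l t =
    (z + b t0) ^+ l t0 * \prod_(t | t != t0) b t ^+ l t.
  rewrite (bigD1 t0) //= eqxx; congr (_ * _).
  by apply: eq_bigr => t /negPf ->.
by rewrite pE hornerZ horner_exp hornerD hornerX hornerC [_ ^+ _ * _]mulrC !mulrA.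
Qed.

Lemma sum_count_mem (I : finType) (u : seq I) :
  (\sum_i count_mem i u)%N = size u.
Proof.
elim: u => [|w u IHu] /=; first by rewrite big1.
rewrite big_split /= IHu (bigD1 w) //= eqxx big1 // => i.
by rewrite eq_sym => /negPf ->.
Qed.

(* Quantifying over an extra monomial u makes closure under multiplication by a
   coordinate immediate. *)
Definition mulform (I : finType) (n : nat) (F : (I -> R) -> R) :=
  forall u : seq I, exists a, forall b,
    F b * \prod_(w <- u) b w = bform (n + size u) (n + size u) a b.

Lemma mulform1 (I : finType) : @mulform I 0 (fun=> 1).
Proof.
move=> u; rewrite add0n.
pose l0 : {ffun I -> 'I_(size u).+1} := [ffun w => inord (count_mem w u)].
have l0E w : l0 w = count_mem w u :> nat.
  by rewrite ffunE inordK // ltnS count_size.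
(* The monomial of [u] is the Bernstein form with the single coefficient 1 / multinomial at the
   exponent vector of [u]. *)
exists (fun l => if [forall w, l w == count_mem w u] then
   (((size u)`!)%:R / (\prod_t (count_mem t u)`!)%:R)^-1 else 0) => b.
rewrite mul1r /bform (bigD1 l0) /=; last first.
  rewrite (eq_bigr (fun w => count_mem w u)); last by move=> w _; rewrite l0E.
  by rewrite sum_count_mem.
rewrite [X in _ + X]big1 ?addr0 => [|l /andP[_ ll0]]; last first.
  case: ifP => [/forallP H|_]; last by rewrite mul0r.
  case/eqP: ll0; apply/ffunP => w; apply: val_inj; apply/eqP.
  by rewrite /= l0E.
have -> : [forall w, l0 w == count_mem w u :> nat] by apply/forallP => w; rewrite l0E.
have -> : (\prod_t (l0 t)`!)%N = (\prod_t (count_mem t u)`!)%N.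
  by apply: eq_bigr => w _; rewrite l0E.
rewrite mulrA mulVf ?mul1r; last first.
  rewrite mulf_neq0 ?invr_eq0 ?pnatr_eq0 -?lt0n ?fact_gt0 //.
  by rewrite prodn_gt0 // => w; exact: fact_gt0.
rewrite [RHS](eq_bigr (fun w => b w ^+ count_mem w u)); last by move=> w _; rewrite l0E.
elim: u {l0 l0E} => [|w u IHu]; first by rewrite big_nil big1.
rewrite big_cons IHu /= [RHS](eq_bigr (fun v => b v ^+ (w == v) * b v ^+ count_mem v u)).
  rewrite big_split /=; congr (_ * _); rewrite (bigD1 w) //= eqxx big1 ?mulr1 //.
  by move=> v vw; rewrite eq_sym (negPf vw).
by move=> v _; rewrite exprD.
Qed.

Lemma mulform_add (I : finType) n (F G : (I -> R) -> R) :
  mulform n F -> mulform n G -> mulform n (fun b => F b + G b).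
Proof.
move=> HF HG u; have [a aP] := HF u; have [a' a'P] := HG u.
exists (fun l => a l + a' l) => b.
rewrite mulrDl aP a'P /bform -big_split /=; apply: eq_bigr => l _.
by rewrite mulrDl.
Qed.

Lemma mulform_scale (I : finType) n s (F : (I -> R) -> R) :
  mulform n F -> mulform n (fun b => s * F b).
Proof.
move=> HF u; have [a aP] := HF u; exists (fun l => s * a l) => b.
by rewrite -mulrA aP /bform mulr_sumr; apply: eq_bigr => l _; rewrite mulrA.
Qed.

Lemma mulform_sum (I : finType) (T : Type) (s : seq T) (P : pred T) n
    (F : T -> (I -> R) -> R) : (forall i, P i -> mulform n (F i)) ->
  mulform n (fun b => \sum_(i <- s | P i) F i b).
Proof.
move=> HF; elim: s => [|i s IHs].
  move=> u; exists (fun=> 0) => b; rewrite big_nil mul0r /bform big1 // => l _.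
  by rewrite mul0r.
case Pi: (P i).
  move=> u; have [a aP] := mulform_add (HF i Pi) IHs u; exists a => b.
  by rewrite big_cons Pi aP.
by move=> u; have [a aP] := IHs u; exists a => b; rewrite big_cons Pi aP.
Qed.

Lemma mulform_coord (I : finType) n (F : (I -> R) -> R) (t : I) :
  mulform n F -> mulform n.+1 (fun b => b t * F b).
Proof.
move=> HF u; have [a aP] := HF (t :: u); exists a => b.
by rewrite addSnnS -aP big_cons mulrCA mulrA.
Qed.

(** Both the Cartesian coordinates and the total mass are linear forms in the barycentric
    coordinates, so this step builds up all monomials needed for a polynomial. *)
Lemma mulform_linear (I : finType) n (F : (I -> R) -> R) (A : I -> R) e :
  mulform n F -> mulform (e + n) (fun b => (\sum_t A t * b t) ^+ e * F b).
Proof.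
move=> HF; elim: e => [|e IHe].
  by move=> u; have [a aP] := HF u; exists a => b; rewrite expr0 mul1r aP.
have := @mulform_sum I I (index_enum I) xpredT _ _
  (fun t _ => mulform_scale (A t) (mulform_coord t IHe)).
move=> H u; have [a aP] := H u; exists a => b; rewrite -aP exprS; congr (_ * _).
by rewrite -mulrA mulr_suml; apply: eq_bigr => t _; rewrite -mulrA.
Qed.

(** Homogenisation: a monomial of degree e is multiplied by the (d - e)-th power of the total mass,
    which is 1 on weights. It then is a form of degree d in the barycentric coordinates. *)
Lemma mpoly_bform (k : nat) (I : finType) (w : I -> 'rV[R]_k) (d : nat)
    (p : mpoly k R) : (msize p <= d.+1)%N ->
  exists a, forall b : I -> R, is_weight b ->
    meval (fun t => (\sum_i b i *: w i) 0 t) p = bform d d a b.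
Proof.
move=> pd.
have monoP (m : multinom k) : m \in msupp p -> mulform d (fun b =>
    (\sum_i 1 * b i) ^+ (d - mdeg m) *
    \prod_(t <- index_enum 'I_k) (\sum_i w i 0 t * b i) ^+ m t).
  move=> mp.
  have md : (mdeg m <= d)%N by rewrite -ltnS (leq_trans _ pd) // msize_mdeg_lt.
  rewrite -{1}(subnK md).
  apply: mulform_linear; rewrite mdegE.
  elim: (index_enum _) => [|t s IHs].
    rewrite big_nil => u; have [a aP] := mulform1 u; exists a => b.
    by rewrite big_nil aP.
  rewrite big_cons => u; have [a aP] := mulform_linear (fun i => w i 0 t) (m t) IHs u.
  by exists a => b; rewrite big_cons aP.
have := @mulform_sum I _ (msupp p) (mem (msupp p)) d _
  (fun m mp => mulform_scale (mcoeff m p) (monoP m mp)).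
move=> /(_ [::]) [a aP]; exists a => b [_ b1]; move: (aP b).
rewrite big_nil mulr1 addn0 => <-.
rewrite mevalE big_seq; apply: eq_bigr => m _; congr (_ * _).
have -> : \sum_i 1 * b i = 1.
  by transitivity (\sum_i b i) => //; apply: eq_bigr => i _; exact: mul1r.
rewrite expr1n mul1r; apply: eq_bigr => t _; congr (_ ^+ _).
by rewrite summxE; apply: eq_bigr => i _; rewrite mxE mulrC.
Qed.

End bernstein_forms.

(** * Splines as coefficient functions, and determining sets in terms of coefficients *)

Section spline_coefficients.
Context {R : realType} {k : nat}.
Local Notation E := 'rV[R]_k.
Implicit Types (K : set {fset E}) (s : {fset E}) (r d : nat).

(** The scaling factor is a parameter independent of the degree: a domain point of degree j of C_j
    is a combination of vertices of C with factor 1/d. *)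
Definition dpoint (I : finType) (q : R) (v : I -> E) (l : I -> nat) : E :=
  q *: \sum_t (l t)%:R *: v t.

Lemma dpoint_extend (I J : finType) (h : I -> J) (q : R) (v : J -> E) (l : I -> nat) :
  injective h -> dpoint q v (extend 0%N h l) = dpoint q (fun t => v (h t)) l.
Proof.
move=> injh; rewrite /dpoint (@big_inj_codom _ _ _ _ _ h) //.
  by congr (_ *: _); apply: eq_bigr => t _; rewrite extendE.
by move=> t' ht'; rewrite extend_out // scale0r.
Qed.

(** Induction on the gap between the cardinality of [s] and the largest cardinality [B] in the
    finite complex. *)
Lemma sub_maximal_simplex K s : finite_set K -> K s ->
  exists2 s', maximal_simplex K s' & (s `<=` s')%fset.
Proof.
move=> /finite_fsetP[X KX].
pose B := (\max_(s <- X) #|` s|)%N.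
have KB s' : K s' -> (#|` s'| <= B)%N.
  by rewrite KX /= => s'X; exact: (leq_bigmax_seq (F := fun s : {fset E} => #|` s|) s').
have [n] := ubnP (B - #|` s|)%N; elim: n s => // n IHn s sn Ks.
have [[s' Ks' /andP[ss' ns]]|smax] :=
    pselect (exists2 s', K s' & (s `<=` s')%fset && (s' != s)).
  have lt_ss' : (#|` s| < #|` s'|)%N.
    by apply: fproper_ltn_card; rewrite fproperEneq eq_sym ns.
  have [] // := IHn s' _ Ks'.
    by rewrite (leq_trans _ (sn : (_ <= n)%N)) // ltn_sub2l // (leq_trans lt_ss') // KB.
  by move=> s'' ms'' s's''; exists s'' => //; exact: fsubset_trans s's''.
exists s => //; split=> // s' Ks' ss'; apply/eqP; apply: contra_notT smax => ns.
by exists s' => //; rewrite ss'.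
Qed.

(** The admissible coefficient functions. Degree n and factor [q] are decoupled so that the slices
    of a degree-d spline on the join live on the unscaled complex with q = 1/d. *)
Definition form_space K r N n (q : R) : set (E -> R) :=
  [set c | exists2 g : E -> R, Cr_function r g &
     forall s, maximal_simplex K s -> forall b : s -> R, is_weight b ->
     g (\sum_w b w *: vertices w) = bform N n (fun l => c (dpoint q (@vertices R k s) l)) b].

Definition bb_space K r d := form_space K r d d d%:R^-1.

Lemma form_space_lin K r N n q (a : R) (c c' : E -> R) :
  form_space K r N n q c -> form_space K r N n q c' ->
  form_space K r N n q (fun p => c p + a * c' p).
Proof.
move=> [g Cg gP] [g' Cg' g'P]; exists (fun x => g x + a * g' x).
  by apply: Cr_add => //; exact: Cr_scale.
move=> s ms b wb; rewrite gP // g'P // /bform mulr_sumr -big_split /=.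
by apply: eq_bigr => l _; rewrite mulrDl mulrA.
Qed.

Lemma form_space0 K r N n q : form_space K r N n q (fun=> 0).
Proof.
exists (fun=> 0); first exact: Cr_cst.
by move=> s ms b wb; rewrite /bform big1 // => l _; rewrite mul0r.
Qed.

Lemma form_space_sum K r N n q (T : Type) (s : seq T) (a : T -> R) (c : T -> E -> R) :
  (forall t, form_space K r N n q (c t)) ->
  form_space K r N n q (fun p => \sum_(t <- s) a t * c t p).
Proof.
move=> Hc; elim: s => [|t s IHs].
  have -> : (fun p => \sum_(t <- [::]) a t * c t p) = (fun=> 0).
    by apply/funext => p; rewrite big_nil.
  exact: form_space0.
have -> : (fun p => \sum_(u <- t :: s) a u * c u p) =
    (fun p => \sum_(u <- s) a u * c u p + a t * c t p).
  by apply/funext => p; rewrite big_cons addrC.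
exact: form_space_lin.
Qed.

Lemma simplex_polyhedron K s (b : s -> R) : K s -> is_weight b ->
  polyhedron K (\sum_w b w *: vertices w).
Proof. by move=> Ks wb; exists s => //; exists b. Qed.

Definition polyhedron_pt K (x : E) (hx : polyhedron K x) : polyhedron K :=
  exist (fun y => y \in polyhedron K) x (mem_set hx).

Lemma spline_bb_space K r d f c :
  spline_space K r d f -> BB_coefficients d f c -> bb_space K r d c.
Proof.
move=> [[g Cg fg] _] fc; exists g => // s ms b wb.
pose x := polyhedron_pt (simplex_polyhedron (proj1 ms) wb).
by rewrite -(fg x) (fc s ms b wb x).
Qed.

(** Affine independence means that the vectors (v_t, 1) are linearly independent. The matrix [A]
    with these rows has a right inverse, whose columns are the coefficients of the barycentric
    coordinates as affine functions. *)
Lemma barycentric_mpoly (I : finType) (v : I -> E) : affinely_independent v ->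
  exists2 beta : I -> mpoly k R, forall t, (msize (beta t) <= 2)%N &
    forall b, \sum_t b t = 1 -> forall t,
      meval (fun u => (\sum_t b t *: v t) 0 u) (beta t) = b t.
Proof.
move=> aff.
pose A : 'M[R]_(#|I|, k + 1) := \matrix_i row_mx (v (enum_val i)) (1 : 'rV_1).
have mulA (x : 'rV[R]_#|I|) : x *m A =
    row_mx (\sum_t x 0 (enum_rank t) *: v t) (const_mx (\sum_t x 0 (enum_rank t))).
  apply/rowP => j; rewrite mxE (reindex (@enum_rank I)) /=; last first.
    exact: onW_bij (enum_rank_bij I).
  case: (split_ordP j) => u ->.
    rewrite row_mxEl summxE; apply: eq_bigr => t _.
    by rewrite [A _ _]mxE row_mxEl enum_rankK [RHS]mxE.
  rewrite row_mxEr mxE; apply: eq_bigr => t _.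
  by rewrite [A _ _]mxE row_mxEr (ord1 u) mxE eqxx mulr1.
have freeA : row_free A.
  apply: inj_row_free => x; rewrite mulA => /eqP; rewrite row_mx_eq0.
  move=> /andP[/eqP x0 /eqP /matrixP /(_ 0 0)]; rewrite !mxE => x1.
  apply/rowP => i; rewrite mxE -[i]enum_valK.
  by rewrite (aff (fun t => x 0 (enum_rank t)) x1 x0 (enum_val i)).
pose B := pinvmx A.
exists (fun t => \sum_u B (lshift 1 u) (enum_rank t) *: mpolyX R (mnm1 u) +
                 mpolyC k (B (rshift k 0) (enum_rank t))).
  move=> t; apply: (leq_trans (mmeasureD_le _ _ _)).
  rewrite geq_max; apply/andP; split.
    apply: (leq_trans (mmeasure_sum _ _ _ _)); apply/bigmax_leqP => u _.
    by apply: (leq_trans (msizeZ_le _ _)); rewrite msizeX mdeg1.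
  by rewrite mmeasureC; case: (_ != _).
move=> b b1 t; pose x : 'rV[R]_#|I| := \row_i b (enum_val i).
have xA : x *m A = row_mx (\sum_t b t *: v t) 1.
  rewrite mulA; congr row_mx.
    by apply: eq_bigr => u _; rewrite mxE enum_rankK.
  apply/matrixP => i j; rewrite !mxE (ord1 i) (ord1 j) eqxx -b1.
  by apply: eq_bigr => u _; rewrite mxE enum_rankK.
have := congr1 (fun M => (M *m B) 0 (enum_rank t)) xA.
rewrite -mulmxA mulmxVp // mulmx1 mxE enum_rankK => ->.
rewrite [RHS]mxE big_split_ord /= mevalD mevalC raddf_sum /= big_ord1 row_mxEr.
rewrite [X in X * B _ _]mxE ?eqxx mul1r.
congr (_ + _); apply: eq_bigr => u _.
by rewrite mevalZ mevalXU row_mxEl mulrC.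
Qed.

Lemma msize_mul_leq (p q : mpoly k R) m n :
  (msize p <= m.+1)%N -> (msize q <= n.+1)%N -> (msize (p * q) <= (m + n).+1)%N.
Proof.
move=> pm qn; have [->|p0] := eqVneq p 0; first by rewrite mul0r mmeasure0.
have [->|q0] := eqVneq q 0; first by rewrite mulr0 mmeasure0.
rewrite msizeM // -ltnS prednK; last by rewrite addn_gt0 lt0n mmeasure_poly_eq0 p0.
by apply: (leq_trans (leq_add pm qn)); rewrite addSn addnS.
Qed.

Lemma msize_prod_exp_leq (I : finType) (beta : I -> mpoly k R) (l : I -> nat) :
  (forall t, msize (beta t) <= 2)%N ->
  (msize (\prod_t beta t ^+ l t) <= (\sum_t l t).+1)%N.
Proof.
move=> b2; elim/big_ind2 : _ => [|p m q n|t _]; first by rewrite msize1.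
  by move=> pm qn; exact: msize_mul_leq.
elim: (l t) => [|n IHn]; first by rewrite expr0 msize1.
by rewrite exprS; exact: (@msize_mul_leq _ _ 1 n).
Qed.

(** Converse to [spline_bb_space]: substituting the affine polynomials for the barycentric
    coordinates makes each Bernstein form a polynomial of degree at most d. *)
Lemma form_spline K r d g c : Cr_function r g ->
  (forall s, maximal_simplex K s -> affinely_independent (@vertices R k s)) ->
  (forall s, maximal_simplex K s -> forall b : s -> R, is_weight b ->
     g (\sum_w b w *: vertices w) =
     bform d d (fun l => c (dpoint d%:R^-1 (@vertices R k s) l)) b) ->
  spline_space K r d (fun x => g (val x)) /\
  @BB_coefficients R k K d (fun x => g (val x)) c.
Proof.
move=> Cg aff gP; split; last by move=> s ms b wb x ->; exact: gP.
split; first by exists g.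
move=> s ms; have [beta b2 betaP] := barycentric_mpoly (aff s ms).
exists (\sum_(l : {ffun s -> 'I_d.+1} | (\sum_t l t)%N == d)
  (c (dpoint d%:R^-1 (@vertices R k s) (fun t => l t)) *
   ((d`!)%:R / (\prod_t (l t)`!)%:R)) *: \prod_t beta t ^+ l t).
  apply: (leq_trans (mmeasure_sum _ _ _ _)); apply/bigmax_leqP => l /eqP sl.
  apply: (leq_trans (msizeZ_le _ _)); rewrite -[X in (_ <= X.+1)%N]sl.
  exact: (msize_prod_exp_leq (fun t => nat_of_ord (l t))).
move=> x [b wb ->]; rewrite gP // raddf_sum; apply: eq_bigr => l _.
rewrite /= mevalZ mulrA; congr (_ * _); rewrite [RHS]rmorph_prod.
by apply: eq_bigr => t _; rewrite rmorphXn /= betaP //; case: wb.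
Qed.

(** A multi-index on a face extends by 0 to a maximal simplex without moving its domain point. *)
Lemma domain_points_maximal K d p : finite_set K -> domain_points K d p ->
  exists2 s, maximal_simplex K s &
    exists2 l : {ffun s -> 'I_d.+1}, (\sum_t l t)%N = d &
      p = dpoint d%:R^-1 (@vertices R k s) (fun t => l t).
Proof.
move=> Kfin [s Ks [l /eqP sl <-]].
have [s' ms' ss'] := sub_maximal_simplex Kfin Ks; exists s' => //.
pose h := fincl ss'; have injh : injective h by exact: fincl_inj.
pose l' : {ffun s' -> 'I_d.+1} := [ffun t => extend ord0 h l t].
have l'E : (fun t => nat_of_ord (l' t)) = extend 0%N h (fun t => l t).
  by apply/funext => t; rewrite ffunE /extend; case: pickP.
exists l'; last by rewrite l'E dpoint_extend.
rewrite -[RHS]sl (@big_inj_codom _ _ _ _ _ h) //.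
  by apply: eq_bigr => t _; rewrite ffunE extendE.
by move=> t ht; rewrite ffunE extend_out.
Qed.

Lemma maximal_domain_points K d s (l : {ffun s -> 'I_d.+1}) :
  K s -> (\sum_t l t)%N = d ->
  domain_points K d (dpoint d%:R^-1 (@vertices R k s) (fun t => l t)).
Proof. by move=> Ks sl; exists s => //; exists l => //; exact/eqP. Qed.

Lemma domain_points_finite K d : finite_set K -> finite_set (domain_points K d).
Proof.
move=> Kfin; apply: bigcup_finite => // s _.
apply: finite_image; exact: finite_finset.
Qed.

Section determining.
Variables (K : set {fset E}) (r d : nat).
Hypothesis Kfin : finite_set K.
Hypothesis Kne : forall s, maximal_simplex K s -> s != fset0.
Hypothesis Kaff :
  forall s, maximal_simplex K s -> affinely_independent (@vertices R k s).

Lemma polyhedron_maximal x : polyhedron K x ->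
  exists2 s, maximal_simplex K s & exists2 b : s -> R, is_weight b &
    x = \sum_w b w *: vertices w.
Proof.
move=> [s Ks [b [b0 b1] ->]].
have [s' ms' ss'] := sub_maximal_simplex Kfin Ks; exists s' => //.
pose h := fincl ss'; have injh : injective h by exact: fincl_inj.
exists (extend 0 h b).
  split=> [t|]; first by rewrite /extend; case: pickP.
  rewrite (@big_inj_codom _ _ _ _ _ h) // => [|t ht]; last by rewrite extend_out.
  by rewrite -b1; apply: eq_bigr => t _; rewrite extendE.
rewrite [RHS](@big_inj_codom _ _ _ _ _ h) // => [|t ht].
  by apply: eq_bigr => t _; rewrite extendE.
by rewrite extend_out // scale0r.
Qed.

(** Uniqueness of the Bernstein form on each maximal simplex, together with the fact that these
    simplices cover the polyhedron. *)
Lemma BB_zero (f : polyhedron K -> R) c : BB_coefficients d f c ->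
  (forall x, f x = 0) <-> (forall p, domain_points K d p -> c p = 0).
Proof.
move=> fc; split=> [f0 p|c0 x].
  move=> /(domain_points_maximal Kfin)[s ms [l sl ->]].
  have /fset0Pn[w ws] := Kne ms.
  apply: (bform_eq0 [` ws]%fset (a := fun l => c (dpoint d%:R^-1 (@vertices R k s) l))) sl.
  move=> b wb.
  pose x := polyhedron_pt (simplex_polyhedron (proj1 ms) wb).
  by have := fc s ms b wb x erefl; rewrite f0.
have [s ms [b wb xE]] := polyhedron_maximal (set_mem (valP x)).
rewrite (fc s ms b wb x xE) big1 // => l /eqP sl.
rewrite c0 ?mul0r //; exact: maximal_domain_points (proj1 ms) sl.
Qed.

(** Passing from splines to their coefficients turns the determining property into linear algebra on
    [bb_space]. *)
Lemma determining_bb M : determining_set d (spline_space K r d) M <->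
  M `<=` domain_points K d /\
  forall c, bb_space K r d c -> (forall p, M p -> c p = 0) ->
    forall p, domain_points K d p -> c p = 0.
Proof.
split=> -[MD Mdet]; split=> //.
  move=> c [g Cg gP] cM.
  have [Sg gc] := form_spline Cg Kaff gP.
  by apply/(BB_zero gc); exact: Mdet Sg gc cM.
move=> f c Sf fc cM; apply/(BB_zero fc).
exact: Mdet (spline_bb_space Sf fc) cM.
Qed.

(** If each admissible c vanishing on M except possibly at p also vanished at p, then M without p
    would be a smaller determining set. So some c has c p nonzero, and it is normalised. *)
Lemma minimal_dual M : minimal_determining_set d (spline_space K r d) M ->
  forall p, M p -> exists c, [/\ bb_space K r d c, c p = 1 &
    forall q, M q -> q <> p -> c q = 0].
Proof.
move=> [/determining_bb[MD Mdet] Mmin] p Mp.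
have Mfin : finite_set M := sub_finite_set MD (domain_points_finite d Kfin).
have [c [cW cM cp]] : exists c, [/\ bb_space K r d c,
    forall q, M q -> q <> p -> c q = 0 & c p <> 0].
  apply: contrapT => noc.
  have /Mmin leM : determining_set d (spline_space K r d) (M `\ p).
    apply/determining_bb; split=> [q [/MD //]|c cW cM q].
    apply: (Mdet c cW) => u Mu; have [->|up] := pselect (u = p); last exact: cM.
    apply: contrapT => cp; apply: noc; exists c; split=> // v Mv vp.
    exact: cM.
  have [n Mn] := (finite_setP M).1 Mfin.
  have := @leq_card_fset_set _ (M `\ p) n.
  rewrite -(card_le_eql Mn) => /(_ (finite_setD _ Mfin) leM).
  rewrite fset_setD1 // -(card_fset_set Mn) (cardfsD1 p (fset_set M)).
  by rewrite in_fset_set // mem_set // add1n ltnn.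
exists (fun q => 0 + (c p)^-1 * c q); split.
- exact: form_space_lin (form_space0 _ _ _ _ _) cW.
- by rewrite add0r mulVf //; exact/eqP.
- by move=> q Mq qp; rewrite (cM q) // mulr0 addr0.
Qed.

(** * Determining sets that carry a dual family of coefficient functions *)

Section dual_family.
Variables (T : finType) (e : T -> E) (cf : T -> E -> R).
Hypothesis cfW : forall t, bb_space K r d (cf t).
Hypothesis cfe : forall t t', cf t (e t') = (t == t')%:R.
Hypothesis edet : determining_set d (spline_space K r d) (range e).

(** Let N be determining. A combination of the [cf t] that vanishes on N vanishes at all [e t], so
    its coefficients are 0. The matrix of values of the [cf t] on N thus has independent rows, and N
    has at least as many points as T. *)
Lemma dual_minimal : minimal_determining_set d (spline_space K r d) (range e).
Proof.
split=> // N /determining_bb[ND Ndet].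
have Nfin : finite_set N := sub_finite_set ND (domain_points_finite d Kfin).
have [eD _] := (determining_bb _).1 edet.
pose X := fset_set N.
pose A : 'M[R]_(#|T|, #|{: X}|) :=
  \matrix_(i, j) cf (enum_val i) (val (enum_val j)).
have freeA : row_free A.
  apply: inj_row_free => x xA.
  pose c p := \sum_t x 0 (enum_rank t) * cf t p.
  have cW : bb_space K r d c by exact: form_space_sum.
  have cN p : N p -> c p = 0.
    move=> Np; have pX : p \in X by rewrite in_fset_set // mem_set.
    have := congr1 (fun M : 'rV[R]_#|{: X}| => M 0 (enum_rank [` pX]%fset)) xA.
    rewrite !mxE => <-; rewrite /c (reindex (@enum_val T predT)) /=; last first.
      exact: onW_bij (enum_val_bij T).
    by apply: eq_bigr => i _; rewrite mxE enum_valK enum_rankK.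
  apply/rowP => i; rewrite mxE.
  have := Ndet c cW cN (e (enum_val i)) (eD _ _).
  move=> /(_ (ex_intro2 _ _ _ I erefl)); rewrite /c (bigD1 (enum_val i)) //=.
  rewrite big1 ?addr0 ?cfe ?eqxx ?mulr1 ?enum_valK // => t /negPf ti.
  by rewrite cfe ti mulr0.
have leTX : (#|T| <= #|` X|)%N.
  by rewrite cardfE -(eqP freeA) rank_leq_col.
have [n Nn] := (finite_setP N).1 Nfin.
rewrite (card_le_eqr Nn).
have -> : range e = [set (e \o enum_val) i | i in [set: 'I_#|T|]].
  apply/seteqP; split=> [_ [t _ <-]|_ [i _ <-]] /=; last by exists (enum_val i).
  by exists (enum_rank t) => //=; rewrite enum_rankK.
apply: card_le_trans (card_image_le _ _) _.
rewrite -(card_le_eql card_II) card_le_II (leq_trans leTX) //.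
by rewrite /X (card_fset_set Nn).
Qed.

(** The splines with coefficients [cf t] form a basis. A spline with coefficients c is the
    combination with factors c (e t), because the difference vanishes on the determining set. *)
Lemma dual_has_dim :
  (forall f, spline_space K r d f -> exists c, BB_coefficients d f c) ->
  has_dim (spline_space K r d) #|T|.
Proof.
move=> BBex.
have /choice[g gP] t : exists g, Cr_function r g /\
  (forall s, maximal_simplex K s -> forall b : s -> R, is_weight b ->
     g (\sum_w b w *: vertices w) =
     bform d d (fun l => cf t (dpoint d%:R^-1 (@vertices R k s) l)) b).
  by have [g Cg gP] := cfW t; exists g.
pose f t (x : polyhedron K) := g t (val x).
have fP t := form_spline (gP t).1 Kaff (gP t).2.
have [eD edet'] := (determining_bb _).1 edet.
have BB_sum (a : T -> R) : @BB_coefficients R k K d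
    (fun x => \sum_t a t * f t x) (fun p => \sum_t a t * cf t p).
  move=> s ms b wb x xE.
  under eq_bigr => t _ do rewrite /f ((fP t).2 s ms b wb x xE) mulr_sumr.
  rewrite exchange_big; apply: eq_bigr => l _ /=.
  by rewrite mulr_suml; apply: eq_bigr => t _; rewrite mulrA.
have cfsum (a : T -> R) t0 : \sum_t a t * cf t (e t0) = a t0.
  rewrite (bigD1 t0) //= big1 ?addr0 ?cfe ?eqxx ?mulr1 // => t /negPf tt0.
  by rewrite cfe tt0 mulr0.
have enumsum (F : T -> R) : \sum_(i < #|T|) F (enum_val i) = \sum_t F t.
  rewrite [RHS](reindex (@enum_val T predT)) //; exact: onW_bij (enum_val_bij T).
exists (fun i => f (enum_val i)); split=> [i|a a0 i|h Sh].
- exact: (fP _).1.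
- pose a' t := a (enum_rank t).
  have f0 x : \sum_t a' t * f t x = 0.
    apply: etrans (a0 x); rewrite -(enumsum (fun t => a' t * f t x)); apply: eq_bigr => j _.
    by rewrite /a' enum_valK.
  have := ((BB_zero (BB_sum a')).1 f0 (e (enum_val i))).
  rewrite cfsum /a' enum_valK; apply; apply: eD.
  by exists (enum_val i).
- have [c hc] := BBex h Sh; pose a t := c (e t).
  exists (fun i => a (enum_val i)) => x.
  rewrite (enumsum (fun t => a t * f t x)); apply/eqP; rewrite -subr_eq0; apply/eqP.
  pose c' p := c p + (-1) * \sum_t a t * cf t p.
  have BBc' : @BB_coefficients R k K d (fun x => h x - \sum_t a t * f t x) c'.
    move=> s ms b wb y yE; rewrite (hc s ms b wb y yE) (BB_sum a s ms b wb y yE).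
    by rewrite -sumrB; apply: eq_bigr => l _; rewrite /c' mulN1r mulrBl.
  apply: (BB_zero BBc').2 => p; apply: edet'.
    apply: form_space_lin; first exact: spline_bb_space Sh hc.
    exact: form_space_sum.
  by move=> _ [t _ <-]; rewrite /c' cfsum mulN1r subrr.
Qed.

End dual_family.

End determining.

(** Extension by zero lets barycentric coordinates on different simplices be compared at the same
    point of R^k. *)
Definition extE s (b : s -> R) (z : E) : R :=
  if (insub z : option s) is Some w then b w else 0.

Lemma extE_in s (b : s -> R) (w : s) : extE b (val w) = b w.
Proof. by rewrite /extE valK. Qed.

Lemma extE_out s (b : s -> R) z : z \notin s -> extE b z = 0.
Proof. by move=> zs; rewrite /extE insubF //; exact/negbTE. Qed.

(* Maximal simplices meet in common faces, in terms of barycentric coordinates. *)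
Definition face_to_face K := forall s s', maximal_simplex K s ->
  maximal_simplex K s' -> forall (b : s -> R) (b' : s' -> R),
  is_weight b -> is_weight b' ->
  \sum_w b w *: vertices w = \sum_w b' w *: vertices w ->
  forall z, extE b z = extE b' z.

(** A domain point shared by two simplices has its multi-index supported on their common face. Both
    forms restrict there to f, and uniqueness of Bernstein forms on that face equates the
    coefficients. *)
Lemma face_to_face_coeff K d (f : polyhedron K -> R) :
  face_to_face K -> (d = 0%N -> forall s, maximal_simplex K s -> 0 \in s) ->
  forall s s' (a : (s -> nat) -> R) (a' : (s' -> nat) -> R)
    (l : {ffun s -> 'I_d.+1}) (l' : {ffun s' -> 'I_d.+1}),
  maximal_simplex K s -> maximal_simplex K s' ->
  (forall b, is_weight b -> forall x, val x = \sum_w b w *: vertices w ->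
    f x = bform d d a b) ->
  (forall b, is_weight b -> forall x, val x = \sum_w b w *: vertices w ->
    f x = bform d d a' b) ->
  (\sum_t l t)%N = d -> (\sum_t l' t)%N = d ->
  dpoint d%:R^-1 (@vertices R k s) (fun t => l t) =
  dpoint d%:R^-1 (@vertices R k s') (fun t => l' t) ->
  a (fun t => l t) = a' (fun t => l' t).
Proof.
move=> ff K0 s s' a a' l l' ms ms' fa fa' sl sl' ll'.
(* In degree 0 every domain point is the origin whatever the simplex, and both coefficients are the
   value of f at the origin. *)
have [d0|d_gt0] := posnP d.
  subst d.
  have at0 s1 (a1 : (s1 -> nat) -> R) (l1 : {ffun s1 -> 'I_1}) : maximal_simplex K s1 ->
    (forall b, is_weight b -> forall x, val x = \sum_w b w *: vertices w ->
      f x = bform 0 0 a1 b) -> forall x, val x = 0 -> f x = a1 (fun t => l1 t).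
    move=> ms1 fa1 x x0; have s10 := K0 erefl s1 ms1.
    pose b (w : s1) : R := (w == [` s10]%fset)%:R.
    have b0 (F : s1 -> E) : \sum_w b w *: F w = F [` s10]%fset.
      rewrite (bigD1 [` s10]%fset) //= big1 ?addr0 /b ?eqxx ?scale1r // => w /negPf ->.
      by rewrite scale0r.
    rewrite (fa1 b) ?x0 ?b0 //; last first.
      split=> [w|]; first exact: ler0n.
      rewrite (bigD1 [` s10]%fset) //= big1 ?addr0 /b ?eqxx // => w /negPf -> //.
    by rewrite bform_deg0; congr a1; apply/funext => t; rewrite ord1.
  have s0 := K0 erefl s ms.
  have P0 : polyhedron K 0.
    exists s; first exact: (proj1 ms).
    exists (fun w => (w == [` s0]%fset)%:R).
      split=> [w|]; first exact: ler0n.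
      rewrite (bigD1 [` s0]%fset) //= big1 ?addr0 ?eqxx // => w /negPf -> //.
    rewrite (bigD1 [` s0]%fset) //= big1 ?addr0 ?eqxx ?scale1r // => w /negPf ->.
    by rewrite scale0r.
  pose x := polyhedron_pt P0.
  by rewrite -(at0 s a l ms fa x erefl) (at0 s' a' l' ms' fa' x erefl).
have dN0 : d%:R != 0 :> R by rewrite pnatr_eq0 -lt0n.
(* For d > 0 the domain point of l has barycentric coordinates l / d, so [face_to_face] applies to
   it. *)
have wl s1 (l1 : {ffun s1 -> 'I_d.+1}) : (\sum_t l1 t)%N = d ->
    is_weight (fun t => d%:R^-1 * (l1 t)%:R : R).
  move=> sl1; split=> [t|]; first by rewrite mulr_ge0 ?invr_ge0 ?ler0n.
  by rewrite -mulr_sumr -natr_sum sl1 mulVf.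
have sumE s1 (l1 : {ffun s1 -> 'I_d.+1}) :
    \sum_t (d%:R^-1 * (l1 t)%:R : R) *: vertices t =
    dpoint d%:R^-1 (@vertices R k s1) (fun t => l1 t).
  by rewrite /dpoint scaler_sumr; apply: eq_bigr => t _; rewrite scalerA.
have eqb := ff s s' ms ms' _ _ (wl s l sl) (wl s' l' sl') _.
have {}eqb := eqb (etrans (sumE s l) (etrans ll' (esym (sumE s' l')))).
pose Z := (s `&` s')%fset.
pose h : Z -> s := fincl (fsubsetIl s s').
pose h' : Z -> s' := fincl (fsubsetIr s s').
have injh : injective h by exact: fincl_inj.
have injh' : injective h' by exact: fincl_inj.
have hh' z : l (h z) = l' (h' z) :> nat.
  have := eqb (val z); rewrite -[val z in LHS]/(val (h z)) extE_in.
  rewrite -[val z]/(val (h' z)) extE_in => /(mulfI (invr_neq0 dN0)) /eqP.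
  by rewrite eqr_nat => /eqP.
pose lZ : {ffun Z -> 'I_d.+1} := [ffun z => l (h z)].
have lE : (fun t => nat_of_ord (l t)) = extend 0%N h (fun z => lZ z).
  apply/funext => w; rewrite /extend; case: pickP => [z /eqP <-|hw].
    by rewrite ffunE.
  have [ws'|ws'] := boolP (val w \in s').
    have wZ : val w \in Z by rewrite in_fsetI (valP w).
    have := hw [` wZ]%fset; rewrite -val_eqE /= eqxx //.
  have := eqb (val w); rewrite extE_in extE_out // => /eqP.
  by rewrite mulf_eq0 invr_eq0 (negPf dN0) /= pnatr_eq0 => /eqP.
have l'E : (fun t => nat_of_ord (l' t)) = extend 0%N h' (fun z => lZ z).
  apply/funext => w; rewrite /extend; case: pickP => [z /eqP <-|hw].
    by rewrite ffunE hh'.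
  have [ws|ws] := boolP (val w \in s).
    have wZ : val w \in Z by rewrite in_fsetI (valP w) ws.
    have := hw [` wZ]%fset; rewrite -val_eqE /= eqxx //.
  have := eqb (val w); rewrite extE_in extE_out // => /esym /eqP.
  by rewrite mulf_eq0 invr_eq0 (negPf dN0) /= pnatr_eq0 => /eqP.
have sZ : (\sum_z lZ z)%N = d.
  rewrite -[RHS]sl (eq_bigr (extend 0%N h (fun z => lZ z))); last first.
    by move=> t _; rewrite -lE.
  rewrite [RHS](@big_inj_codom _ _ _ _ _ h) //.
    by apply: eq_bigr => z _; rewrite extendE.
  by move=> t ht; rewrite extend_out.
(* The total d of the multi-index is positive, so the common face is nonempty. *)
have [z0 _] : exists z0 : Z, true.
  apply: contrapT => noZ; move: d_gt0; rewrite -sZ big1 // => z _.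
  by case: noZ; exists z.
rewrite lE l'E.
apply: (bform_unique z0 (a := fun l => a (extend 0%N h l))
  (a' := fun l => a' (extend 0%N h' l))) sZ => b wb.
have wext s1 (h1 : Z -> s1) : injective h1 -> is_weight (extend 0 h1 b).
  move=> injh1; case: wb => b0 b1.
  split=> [t|]; first by rewrite /extend; case: pickP.
  rewrite (@big_inj_codom _ _ _ _ _ h1) // => [|t ht]; last by rewrite extend_out.
  by rewrite -b1; apply: eq_bigr => t _; rewrite extendE.
have pext s1 (h1 : Z -> s1) : injective h1 -> (forall z, val (h1 z) = val z) ->
    \sum_w extend 0 h1 b w *: vertices w = \sum_z b z *: vertices z.
  move=> injh1 vh1; rewrite [LHS](@big_inj_codom _ _ _ _ _ h1) // => [|t ht].
    by apply: eq_bigr => z _; rewrite extendE // /vertices vh1.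
  by rewrite extend_out // scale0r.
have fext s1 (h1 : Z -> s1) (a1 : (s1 -> nat) -> R) : injective h1 ->
    bform d d (fun l => a1 (extend 0%N h1 l)) b = bform d d a1 (extend 0 h1 b).
  move=> injh1; rewrite (bform_inj (h := h1)) //; last by move=> t ht; rewrite extend_out.
  by congr bform; apply/funext => z; rewrite extendE.
have Px : polyhedron K (\sum_z b z *: vertices z).
  rewrite -(pext s h) //; apply: simplex_polyhedron; [exact: (proj1 ms)|exact: wext].
pose x := polyhedron_pt Px.
rewrite !fext // -(fa _ (wext _ h injh) x); last by rewrite pext.
by rewrite -(fa' _ (wext _ h' injh') x) // pext.
Qed.

Lemma BB_coefficients_exist K d (f : polyhedron K -> R) :
  face_to_face K -> (d = 0%N -> forall s, maximal_simplex K s -> 0 \in s) ->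
  (forall s, maximal_simplex K s -> poly_on (conv_hull (@vertices R k s)) d f) ->
  exists c, BB_coefficients d f c.
Proof.
move=> ff K0 fpoly.
(* All values that Bernstein forms of f on maximal simplices attach to z; by [face_to_face_coeff]
   there is at most one, so the choice made by [xget] is consistent. *)
pose Y z := [set y : R | exists s, exists a : (s -> nat) -> R,
  exists l : {ffun s -> 'I_d.+1}, [/\ maximal_simplex K s,
    forall b, is_weight b -> forall x, val x = \sum_w b w *: vertices w ->
      f x = bform d d a b, (\sum_t l t)%N = d,
    z = dpoint d%:R^-1 (@vertices R k s) (fun t => l t) & y = a (fun t => l t)]].
exists (fun z => xget 0 (Y z)) => s ms b wb x xE.
have [p pd fp] := fpoly s ms.
have [a aP] := mpoly_bform (@vertices R k s) pd.
have fa b1 : is_weight b1 -> forall x1, val x1 = \sum_w b1 w *: vertices w ->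
    f x1 = bform d d a b1.
  move=> wb1 x1 x1E; rewrite fp; last by exists b1.
  by rewrite x1E aP.
rewrite (fa b wb x xE); apply: eq_bigr => l /eqP sl; congr (_ * _).
have /(xgetPex 0) : exists y, Y (domain_point (@vertices R k s) l) y.
  by exists (a (fun t => l t)); exists s, a, l; split.
move=> [s' [a' [l' [ms' fa' sl' zE ->]]]].
exact: (face_to_face_coeff ff K0 ms ms' fa fa' sl sl' zE).
Qed.

End spline_coefficients.

(** * Change of index type for the vertices of a simplex; complexes are face-to-face *)

Section reparametrisation.
Context {R : realType} {k : nat}.
Local Notation E := 'rV[R]_k.
Implicit Types (K : set {fset E}) (s : {fset E}).

Lemma big_bij (I J : finType) (T : Type) (idx : T) (op : Monoid.com_law idx)
    (h : I -> J) (F : J -> T) : injective h -> (forall z, exists t, h t = z) ->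
  \big[op/idx]_z F z = \big[op/idx]_t F (h t).
Proof.
move=> injh surjh; apply: big_inj_codom => // z hz.
by have [t tz] := surjh z; have := hz t; rewrite tz eqxx.
Qed.

Section simplex.
Variables (I : finType) (s : {fset E}) (h : I -> s).
Hypothesis injh : injective h.
Hypothesis surjh : forall z, exists t, h t = z.

(** Replaces the vertices of a scaled simplex by those of the original one, and the vertices of a
    join by a disjoint union. *)
Lemma simplex_reparam (g c : E -> R) N n q :
  (forall b : s -> R, is_weight b -> g (\sum_w b w *: vertices w) =
     bform N n (fun l => c (dpoint q (@vertices R k s) l)) b) <->
  (forall b : I -> R, is_weight b -> g (\sum_t b t *: vertices (h t)) =
     bform N n (fun l => c (dpoint q (fun t => vertices (h t)) l)) b).
Proof.
have bE (b : s -> R) : bform N n (fun l => c (dpoint q (@vertices R k s) l)) b =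
    bform N n (fun l => c (dpoint q (fun t => vertices (h t)) l)) (fun t => b (h t)).
  rewrite (bform_inj (h := h)) // => [|z hz]; last first.
    by have [t tz] := surjh z; have := hz t; rewrite tz eqxx.
  by apply: bform_ext => l _; rewrite dpoint_extend.
split=> H b [b0 b1].
  have be t : extend 0 h b (h t) = b t by rewrite extendE.
  have wb : is_weight (extend 0 h b).
    split=> [t|]; first by rewrite /extend; case: pickP.
    by rewrite (big_bij _ _ injh surjh) -b1; apply: eq_bigr => t _; rewrite be.
  have := H _ wb; rewrite bE (big_bij _ _ injh surjh).
  have -> : (fun t => extend 0 h b (h t)) = b by apply/funext.
  by move=> <-; congr g; apply: eq_bigr => t _; rewrite be.
rewrite bE -H; first by rewrite (big_bij _ _ injh surjh).
by split=> [t|]; [exact: b0|rewrite -b1 [RHS](big_bij _ _ injh surjh)].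
Qed.

Lemma affine_reparam : affinely_independent (fun t => vertices (h t)) ->
  affinely_independent (@vertices R k s).
Proof.
move=> aff b; rewrite !(big_bij _ _ injh surjh) => b0 b1 z.
by have [t <-] := surjh z; exact: (aff (fun t => b (h t))).
Qed.

End simplex.

Lemma extE_extend (Z s : {fset E}) (h : Z -> s) (b : Z -> R) z :
  injective h -> (forall t, val (h t) = val t) -> extE (extend 0 h b) z = extE b z.
Proof.
move=> injh vh; have [zZ|zZ] := boolP (z \in Z).
  by rewrite -[z]/(val [` zZ]%fset) extE_in -vh extE_in extendE.
rewrite [RHS]extE_out //; have [zs|zs] := boolP (z \in s); last exact: extE_out.
rewrite -[z]/(val [` zs]%fset) extE_in extend_out // => t.
by apply: contraNneq zZ => /(congr1 val) /=; rewrite vh => <-; exact: valP.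
Qed.

(** The common point lies in the hull of the common face; by affine independence its coordinates in
    either simplex are those in the face, extended by 0. *)
Lemma complex_face_to_face K : simplicial_complex K -> face_to_face K.
Proof.
move=> Kc s s' [Ks _] [Ks' _] b b' wb wb' bb' z.
have : (conv_hull (@vertices R k s) `&` conv_hull (@vertices R k s'))
    (\sum_w b w *: vertices w) by split; [exists b|exists b'].
rewrite (complex_cap Kc Ks Ks') => -[bz [bz0 bz1] xE].
have ext1 s1 (h : (s `&` s')%fset -> s1) (b1 : s1 -> R) : K s1 -> injective h ->
    (forall t, val (h t) = val t) -> is_weight b1 ->
    \sum_w b1 w *: vertices w = \sum_w bz w *: vertices w ->
    forall u, extE b1 u = extE bz u.
  move=> Ks1 injh vh [_ sb1] b1E u; rewrite -(extE_extend _ _ injh vh).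
  congr (extE _ u); apply/funext => w; apply/eqP; rewrite -subr_eq0; apply/eqP.
  apply: (complex_affine Kc Ks1 (b := fun w => b1 w - extend 0 h bz w)).
    rewrite sumrB sb1 (@big_inj_codom _ _ _ _ _ h) // => [|t ht]; last first.
      by rewrite extend_out.
    rewrite (eq_bigr bz) ?bz1 ?subrr // => t _.
    by rewrite extendE.
  under eq_bigr do rewrite scalerBl.
  rewrite sumrB b1E [X in _ - X](@big_inj_codom _ _ _ _ _ h) // => [|t ht]; last first.
    by rewrite extend_out // scale0r.
  rewrite [X in _ - X](eq_bigr (fun t => bz t *: vertices t)) ?subrr // => t _.
  by rewrite extendE // /vertices vh.
rewrite (ext1 s (fincl (fsubsetIl s s'))) //; last exact: fincl_inj.
rewrite (ext1 s' (fincl (fsubsetIr s s'))) //; first exact: fincl_inj.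
by rewrite -bb'.
Qed.

End reparametrisation.

(** * The scaled complexes C_j and their domain points *)

Section scaled_complex.
Context {R : realType} {k : nat}.
Local Notation E := 'rV[R]_k.
Implicit Types (s : {fset E}).
Variables (C : set {fset E}) (d : nat).
Hypothesis C_complex : simplicial_complex C.

Definition scale_simplex (a : R) s : {fset E} := [fset a *: w | w in s]%fset.

Lemma scale_simplex_sub (a : R) s s' : a != 0 ->
  (scale_simplex a s `<=` scale_simplex a s')%fset = (s `<=` s')%fset.
Proof.
move=> a0; apply/fsubsetP/fsubsetP => ss' w.
  move=> ws; have /ss' : a *: w \in scale_simplex a s by exact: in_imfset.
  by move=> /imfsetP[/= w' w's /(scalerI a0) ->].
by move=> /imfsetP[/= w' w's ->]; apply: in_imfset; exact: ss'.
Qed.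

Lemma maximal_scale (a : R) s : a != 0 -> maximal_simplex C s ->
  maximal_simplex (scale_complex a C) (scale_simplex a s).
Proof.
move=> a0 [Cs smax]; split; first by exists s.
move=> _ [s' Cs' <-]; rewrite -/(scale_simplex a s') scale_simplex_sub //.
by move=> /(smax _ Cs') ->.
Qed.

Lemma maximal_scaleE (a : R) s' : a != 0 ->
  maximal_simplex (scale_complex a C) s' ->
  exists2 s, maximal_simplex C s & s' = scale_simplex a s.
Proof.
move=> a0 [[s Cs <-] s'max]; exists s => //; split=> // s1 Cs1.
rewrite -(scale_simplex_sub _ _ a0) => /s'max H.
have /H /eqP : scale_complex a C (scale_simplex a s1) by exists s1.
rewrite eqEfsubset !scale_simplex_sub // => /andP[s1s ss1].
by apply/eqP; rewrite eqEfsubset s1s.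
Qed.

Definition scale_map (a : R) s (w : s) : scale_simplex a s :=
  [` in_imfset imfset_key (fun w => a *: w) (fsvalP w)]%fset.

Lemma scale_map_val (a : R) s (w : s) : val (scale_map a w) = a *: val w.
Proof. by []. Qed.

Lemma scale_map_inj (a : R) s : a != 0 -> injective (@scale_map a s).
Proof. by move=> a0 w w' /(congr1 val) /= /(scalerI a0) /val_inj. Qed.

Lemma scale_map_surj (a : R) s (z : scale_simplex a s) : exists w, scale_map a w = z.
Proof.
have /imfsetP[/= w ws zE] := fsvalP z; exists [` ws]%fset.
by apply: val_inj; rewrite /= zE.
Qed.

Lemma scale_finite (a : R) : finite_set (scale_complex a C).
Proof. exact/finite_image/(complex_finite C_complex). Qed.

Lemma scale_nonempty (a : R) s : maximal_simplex (scale_complex a C) s -> s != fset0.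
Proof.
move=> [[s' Cs' <-] _]; have /fset0Pn[w ws] := complex_nonempty C_complex Cs'.
by apply/fset0Pn; exists (a *: w); exact: in_imfset.
Qed.

Lemma scale_affine (a : R) s : maximal_simplex (scale_complex a C) s ->
  affinely_independent (@vertices R k s).
Proof.
move=> [[s' Cs' <-] _]; rewrite -/(scale_simplex a s'); have [a0|a0] := eqVneq a 0.
  (* For a = 0 all vertices of the scaled simplex coincide, so the sum of [b] has the single term
     [b t]. *)
  move=> b b1 _ t; rewrite -b1 (bigD1 t) //= big1 ?addr0 // => u /eqP[].
  apply: val_inj; have /imfsetP[/= w _ ->] := fsvalP u.
  by have /imfsetP[/= w' _ ->] := fsvalP t; rewrite a0 !scale0r.
apply: (affine_reparam (scale_map_inj a0) (@scale_map_surj a s')) => b b1 b0.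
apply: (complex_affine C_complex Cs' (b := b)) => //.
apply: (scalerI a0); rewrite scaler0 scaler_sumr; apply: etrans b0.
apply: eq_bigr => t _.
by rewrite /vertices scale_map_val scalerA mulrC -scalerA.
Qed.

(** Since (1/j) (j/d) = 1/d, the degree-j domain points of C_j are those of C with factor 1/d; the
    C^r function is only rescaled. *)
Lemma form_space_scale r j (c : E -> R) : (j <= d)%N ->
  bb_space (scale_complex (j%:R / d%:R) C) r j c <-> form_space C r d j d%:R^-1 c.
Proof.
have [-> _|j0 jd] := posnP j.
  (* In degree 0 both spaces contain every c: the forms are the constant c 0. *)
  rewrite /bb_space /form_space; split=> _; exists (fun=> c 0); try exact: Cr_cst;
  by move=> s ms b wb; rewrite bform_deg0 /dpoint big1 ?scaler0 // => t _; rewrite scale0r.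
set a : R := j%:R / d%:R.
have jN0 : j%:R != 0 :> R by rewrite pnatr_eq0 -lt0n.
have dN0 : d%:R != 0 :> R by rewrite pnatr_eq0 -lt0n (leq_trans j0).
have a0 : a != 0 by rewrite mulf_neq0 ?invr_eq0.
have CrZ (e : R) g : Cr_function r g -> Cr_function r (fun x : E => g (e *: x)).
  move=> Cg; apply: Cr_ext (Cr_diag_affine (const_mx e) 0 Cg) => x.
  by congr g; apply/rowP => u; rewrite !mxE addr0.
have main s (g : E -> R) :
  (forall b : s -> R, is_weight b -> g (a *: \sum_w b w *: vertices w) =
    bform d j (fun l => c (dpoint d%:R^-1 (@vertices R k s) l)) b) <->
  (forall b : scale_simplex a s -> R, is_weight b -> g (\sum_w b w *: vertices w) =
    bform j j (fun l => c (dpoint j%:R^-1 (@vertices R k (scale_simplex a s)) l)) b).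
  rewrite (simplex_reparam (scale_map_inj a0) (@scale_map_surj a s)).
  have E1 (b : s -> R) : \sum_t b t *: vertices (scale_map a t) =
      a *: \sum_w b w *: vertices w.
    rewrite scaler_sumr; apply: eq_bigr => t _.
    by rewrite /vertices scale_map_val scalerA mulrC -scalerA.
  have E2 (b : s -> R) :
      bform j j (fun l => c (dpoint j%:R^-1 (fun t => vertices (scale_map a t)) l)) b =
      bform d j (fun l => c (dpoint d%:R^-1 (@vertices R k s) l)) b.
    rewrite [RHS]bform_bound //; apply: bform_ext => l _; congr c.
    rewrite /dpoint scaler_sumr [RHS]scaler_sumr; apply: eq_bigr => t _.
    rewrite /vertices scale_map_val !scalerA; congr (_ *: _).
    by rewrite /a; field; rewrite jN0 dN0.
  by split=> H b wb; [rewrite E1 E2 H|rewrite -E1 -E2 H].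
split=> -[g Cg gP].
  exists (fun x => g (a *: x)); first exact: CrZ.
  by move=> s ms; apply/main; exact/gP/maximal_scale.
exists (fun x => g (a^-1 *: x)); first exact: CrZ.
move=> _ /(maximal_scaleE a0)[s ms ->]; apply: (main s (fun x => g (a^-1 *: x))).1 => b wb.
by rewrite scalerA mulVf // scale1r gP.
Qed.

Lemma scale_domain_points j s (l : s -> nat) : (j <= d)%N -> C s ->
  (\sum_t l t)%N = j ->
  domain_points (scale_complex (j%:R / d%:R) C) j (dpoint d%:R^-1 (@vertices R k s) l).
Proof.
move=> jd Cs sl; set a : R := j%:R / d%:R.
have Cs' : scale_complex a C (scale_simplex a s) by exists s.
(* In degree 0 all multi-indices vanish and the point is the origin. *)
have [j0|j0] := posnP j.
  subst j.
  have l0 t : l t = 0%N.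
    by apply/eqP; rewrite -leqn0 -[X in (_ <= X)%N]j0 leq_sum_entry.
  have -> : dpoint d%:R^-1 (@vertices R k s) l =
      dpoint (\sum_t l t)%N%:R^-1 (@vertices R k (scale_simplex a s))
        (fun t => ([ffun=> ord0] : {ffun _ -> 'I_(\sum_t l t).+1}) t).
    rewrite /dpoint !big1 ?scaler0 // => t _; first by rewrite ffunE scale0r.
    by rewrite l0 scale0r.
  apply: maximal_domain_points => //.
  by rewrite j0 big1 // => t _; rewrite ffunE.
have jN0 : j%:R != 0 :> R by rewrite pnatr_eq0 -lt0n.
have dN0 : d%:R != 0 :> R by rewrite pnatr_eq0 -lt0n (leq_trans j0).
have a0 : a != 0 by rewrite mulf_neq0 ?invr_eq0.
have injh := @scale_map_inj a s a0; have surjh := @scale_map_surj a s.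
pose l' : {ffun scale_simplex a s -> 'I_j.+1} :=
  [ffun z => inord (extend 0%N (@scale_map a s) l z)].
have l'E z : l' z = extend 0%N (@scale_map a s) l z :> nat.
  have [t <-] := surjh z; rewrite ffunE extendE // inordK // ltnS -sl.
  exact: leq_sum_entry.
have -> : dpoint d%:R^-1 (@vertices R k s) l =
    dpoint j%:R^-1 (@vertices R k (scale_simplex a s)) (fun t => l' t).
  rewrite (_ : (fun t => nat_of_ord (l' t)) = extend 0%N (@scale_map a s) l); last exact/funext.
  rewrite dpoint_extend // /dpoint scaler_sumr [RHS]scaler_sumr.
  apply: eq_bigr => t _.
  rewrite /vertices scale_map_val !scalerA; congr (_ *: _).
  by rewrite /a; field; rewrite jN0 dN0.
apply: maximal_domain_points => //.
rewrite (big_bij _ _ injh surjh) -[RHS]sl; apply: eq_bigr => t _.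
by rewrite l'E extendE.
Qed.

Lemma scale_domain_pointsE j p : (j <= d)%N ->
  domain_points (scale_complex (j%:R / d%:R) C) j p ->
  exists2 s, maximal_simplex C s & exists2 l : s -> nat, (\sum_t l t)%N = j &
    p = dpoint d%:R^-1 (@vertices R k s) l.
Proof.
move=> jd /(domain_points_maximal (scale_finite _))[s' ms' [l sl ->]].
have [j0|j0] := posnP j.
  subst j; have [[s0 Cs0 _] _] := ms'.
  have [s ms _] := sub_maximal_simplex (complex_finite C_complex) Cs0.
  exists s => //; exists (fun=> 0%N); first by rewrite big1.
  rewrite /dpoint !big1 ?scaler0 // => t _; last by rewrite ord1 scale0r.
  by rewrite scale0r.
have jN0 : j%:R != 0 :> R by rewrite pnatr_eq0 -lt0n.
have dN0 : d%:R != 0 :> R by rewrite pnatr_eq0 -lt0n (leq_trans j0).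
have a0 : j%:R / d%:R != 0 :> R by rewrite mulf_neq0 ?invr_eq0.
have [s ms s'E] := maximal_scaleE a0 ms'; subst s'; exists s => //.
have injh := @scale_map_inj _ s a0; have surjh := @scale_map_surj (j%:R / d%:R) s.
exists (fun t => l (scale_map (j%:R / d%:R) t)).
  by rewrite -[RHS]sl [RHS](big_bij _ _ injh surjh).
rewrite /dpoint !scaler_sumr (big_bij _ _ injh surjh).
apply: eq_bigr => t _.
rewrite /vertices scale_map_val !scalerA; congr (_ *: _).
by field; rewrite jN0 dN0.
Qed.

End scaled_complex.

(** * Extending a form from the weights to smaller masses on a star *)

Section star_forms.
Context {R : realType} {k : nat}.
Local Notation E := 'rV[R]_k.

(** The inner sum is the Lagrange polynomial of the node a + 1, written through the inverse
    Vandermonde matrix. *)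
Lemma poly_interpolation (N : nat) : exists mu : 'I_N.+1 -> 'I_N.+1 -> R,
  forall (p : {poly R}) z, (size p <= N.+1)%N ->
  p.[z] = \sum_(a < N.+1) (\sum_(m < N.+1) mu m a * z ^+ m) * p.[(a.+1)%:R].
Proof.
have [mu muP] := vandermonde_dual (R := R) N; exists mu => p z pN.
under eq_bigr do rewrite mulr_suml.
rewrite exchange_big /= (horner_coef_wide z pN); apply: eq_bigr => m _.
under eq_bigr => a _ do rewrite mulrAC (horner_coef_wide _ pN) mulr_sumr mulr_suml.
rewrite exchange_big /= (bigD1 m) //= [X in _ + X]big1 => [|m' /negPf m'm]; last first.
  under eq_bigr => a _ do rewrite mulrCA -mulrA [_ * z ^+ m]mulrC mulrA mulrA.
  rewrite (eq_bigr (fun a : 'I_N.+1 => p`_m' * z ^+ m * (mu m a * a.+1%:R ^+ m'))).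
    by rewrite -mulr_sumr muP eq_sym m'm mulr0.
  by move=> a _; ring.
rewrite addr0 (eq_bigr (fun a : 'I_N.+1 => p`_m * z ^+ m * (mu m a * a.+1%:R ^+ m))).
  by rewrite -mulr_sumr muP eqxx mulr1.
by move=> a _; ring.
Qed.

(* A form H of degree n whose restriction to the weights is g extends to the
   cone of weights of total mass u <= 1: on the line through b in the direction
   of the vertex 0, H is a polynomial in the mass, and at mass a >= 1 homogeneity
   gives a ^ n g (x / a); interpolating at a = 1, ..., N + 1 yields H at mass u. *)
Lemma star_form_interpolation (I : finType) (w : I -> E) (t0 : I) (g : E -> R)
    (N n : nat) (A : (I -> nat) -> R) (mu : 'I_N.+1 -> 'I_N.+1 -> R) :
  (n <= N)%N -> w t0 = 0 ->
  (forall (p : {poly R}) z, (size p <= N.+1)%N ->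
    p.[z] = \sum_(a < N.+1) (\sum_(m < N.+1) mu m a * z ^+ m) * p.[(a.+1)%:R]) ->
  (forall b, is_weight b -> g (\sum_t b t *: w t) = bform N n A b) ->
  forall b, (forall t, 0 <= b t) -> \sum_t b t <= 1 ->
  bform N n A b = \sum_(a < N.+1) (\sum_(m < N.+1) mu m a * (\sum_t b t) ^+ m) *
    ((a.+1)%:R ^+ n * g ((a.+1)%:R^-1 *: \sum_t b t *: w t)).
Proof.
move=> nN w0 muP gP b b0; set u := \sum_t b t => u1.
(* [b1] has total mass 0, so adding z at [t0] gives mass z; at z = u this is [b] again. *)
pose b1 t := if t == t0 then b t - u else b t.
have [p pn pE] := bform_poly N n A b1 t0.
have -> : bform N n A b = p.[u].
  by rewrite pE; congr bform; apply/funext => t; rewrite /b1; case: eqP; rewrite // addrC subrK.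
rewrite (muP p u (leq_trans pn _)) //; apply: eq_bigr => a _; congr (_ * _).
rewrite pE; set z : R := a.+1%:R.
have z1 : 1 <= z by rewrite ler1n.
have z0 : 0 < z by rewrite ltr0n.
(* The weight obtained by dividing by the mass z. Its entry at [t0] is nonnegative because u <= 1 <=
   z, and since [w t0] is 0 the added mass does not move the point. *)
pose b2 t := z^-1 * (if t == t0 then z + b1 t else b1 t).
have sum_t0 (F : I -> R) c : \sum_t (if t == t0 then c + F t else F t) = c + \sum_t F t.
  rewrite (bigD1 t0) //= eqxx [in RHS](bigD1 t0) //= addrA; congr (_ + _).
  by apply: eq_bigr => t /negPf ->.
have wb2 : is_weight b2.
  split=> [t|]; rewrite /b2.
    apply: mulr_ge0; first by rewrite invr_ge0 ltW.
    rewrite /b1; case: eqP => _ //.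
    by rewrite addrCA addr_ge0 // subr_ge0 (le_trans u1).
  rewrite -mulr_sumr sum_t0.
  rewrite (_ : \sum_t b1 t = 0) ?addr0 ?mulVf ?gt_eqF //.
  rewrite -[RHS](subrr u) [RHS]addrC -sum_t0; apply: eq_bigr => t _.
  by rewrite /b1; case: eqP => // _; rewrite addrC.
have sb2 : \sum_t b2 t *: w t = z^-1 *: \sum_t b t *: w t.
  rewrite scaler_sumr; apply: eq_bigr => t _; rewrite scalerA /b2 /b1.
  by case: eqP => // ->; rewrite w0 !scaler0.
rewrite -sb2 gP // /b2 bform_scale mulrA -exprMn mulfV ?gt_eqF //.
by rewrite expr1n mul1r.
Qed.

End star_forms.

(** * The join of C with the simplex on v_1, ..., v_m *)

Section join.
Context {R : realType} {k : nat}.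
Local Notation E := 'rV[R]_k.
Implicit Types (s : {fset E}).
Variables (i r d : nat) (C : set {fset E}) (m : nat) (vv : 'I_m -> E).
Hypothesis C_complex : simplicial_complex C.
Hypothesis C_sub : forall s, C s -> forall w, w \in s ->
  forall t : 'I_k, (i <= t)%N -> w 0 t = 0.
Hypothesis C_star : forall s, maximal_simplex C s -> 0 \in s.
Hypothesis vv_free : forall y : 'I_m -> R, \sum_t y t *: vv t = 0 -> forall t, y t = 0.
Hypothesis vv_sub : forall u (t : 'I_k), (t < i)%N -> vv u 0 t = 0.

Let V : {fset E} := [fset vv t | t in 'I_m]%fset.
Let O' := join_complex C V.

(** Projection onto the subspace where the first i coordinates vanish. It kills C and fixes each
    [vv t], which separates the two factors of the join. *)
Let D : 'M[R]_k := diag_mx (\row_u (i <= u)%N%:R).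
Definition vproj (z : E) : E := z *m D.

Lemma vprojE z u : vproj z 0 u = z 0 u * (i <= u)%N%:R.
Proof. by rewrite /vproj /D mul_mx_diag !mxE. Qed.

Lemma vproj_sum (I : finType) (b : I -> R) (w : I -> E) :
  vproj (\sum_t b t *: w t) = \sum_t b t *: vproj (w t).
Proof.
by rewrite /vproj mulmx_suml; apply: eq_bigr => t _; rewrite -scalemxAl.
Qed.

Lemma vprojD z z' : vproj (z + z') = vproj z + vproj z'.
Proof. exact: mulmxDl. Qed.

Lemma vprojZ a z : vproj (a *: z) = a *: vproj z.
Proof. by rewrite /vproj -scalemxAl. Qed.

Lemma vproj_C s w : C s -> w \in s -> vproj w = 0.
Proof.
move=> Cs ws; apply/rowP => u; rewrite vprojE mxE.
case: leqP => iu; last by rewrite mulr0.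
by rewrite (C_sub Cs ws) // mul0r.
Qed.

Lemma vproj_vv t : vproj (vv t) = vv t.
Proof.
apply/rowP => u; rewrite vprojE; case: leqP => iu; first by rewrite mulr1.
by rewrite vv_sub // mul0r.
Qed.

Lemma vproj_simplex s (b : s -> R) : C s -> vproj (\sum_w b w *: vertices w) = 0.
Proof.
move=> Cs; rewrite vproj_sum big1 // => w _.
by rewrite (vproj_C Cs (fsvalP w)) scaler0.
Qed.

Lemma vproj_span (y : 'I_m -> R) : vproj (\sum_t y t *: vv t) = \sum_t y t *: vv t.
Proof. by rewrite vproj_sum; apply: eq_bigr => t _; rewrite vproj_vv. Qed.

Lemma vv_neq0 t : vv t != 0.
Proof.
apply/negP => /eqP vt0.
have /vv_free /(_ t) : \sum_u (u == t)%:R *: vv u = 0.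
  rewrite (bigD1 t) //= vt0 scaler0 add0r big1 // => u /negPf ->.
  by rewrite scale0r.
by rewrite eqxx => /eqP; rewrite oner_eq0.
Qed.

Lemma vv_span_inj (y y' : 'I_m -> R) :
  \sum_t y t *: vv t = \sum_t y' t *: vv t -> forall t, y t = y' t.
Proof.
move=> yy' t; apply/eqP; rewrite -subr_eq0; apply/eqP.
apply: (vv_free (y := fun t => y t - y' t)).
under eq_bigr do rewrite scalerBl.
by rewrite sumrB yy' subrr.
Qed.

Lemma vv_inj : injective vv.
Proof.
move=> t t' tt'.
have := @vv_span_inj (fun u => (u == t)%:R) (fun u => (u == t')%:R).
have delta x : \sum_u (u == x)%:R *: vv u = vv x.
  by rewrite (bigD1 x) //= eqxx scale1r big1 ?addr0 // => u /negPf ->; rewrite scale0r.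
rewrite !delta => /(_ tt' t); rewrite eqxx => /esym /eqP.
by case: (t =P t') => //= _; rewrite eq_sym oner_eq0.
Qed.

Lemma V_notin_C s w : C s -> w \in s -> w \notin V.
Proof.
move=> Cs ws; apply/negP => /imfsetP[/= t _ wE].
have := vproj_C Cs ws; rewrite wE vproj_vv => /eqP.
by rewrite (negPf (vv_neq0 t)).
Qed.

Lemma vv_V t : vv t \in V. Proof. exact: in_imfset. Qed.

Lemma join_simplex s : maximal_simplex C s -> O' (s `|` V)%fset.
Proof.
move=> ms; split; last by exists s.
by apply/fset0Pn; exists 0; rewrite in_fsetU C_star.
Qed.

(** V meets no simplex of C, so from an inclusion of s and V in w and V follows that of s in w, and
    maximality of s applies. *)
Lemma maximal_join s : maximal_simplex C s -> maximal_simplex O' (s `|` V)%fset.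
Proof.
move=> ms; split; first exact: join_simplex.
move=> s' [_ [w mw s'w]] sV.
have sw : (s `<=` w)%fset.
  apply/fsubsetP => x xs; have /(fsubsetP s'w) : x \in s'.
    by apply: (fsubsetP sV); rewrite in_fsetU xs.
  by rewrite in_fsetU (negPf (V_notin_C (proj1 ms) xs)) orbF.
have ws : w = s by apply: (proj2 ms) => //; exact: (proj1 mw).
by subst w; apply/eqP; rewrite eqEfsubset s'w.
Qed.

Lemma maximal_joinE s' : maximal_simplex O' s' ->
  exists2 s, maximal_simplex C s & s' = (s `|` V)%fset.
Proof.
move=> [[_ [s ms s's]] s'max]; exists s => //.
by apply/esym/s'max => //; exact: join_simplex.
Qed.

Lemma join_finite : finite_set O'.
Proof.
have : finite_set (\bigcup_(s in C) [set` fpowerset (s `|` V)%fset]).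
  by apply: bigcup_finite => [|s _]; [exact: complex_finite C_complex|exact: finite_fset].
apply: sub_finite_set => s [_ [w [Cw _] sw]]; exists w => //=.
by rewrite fpowersetE.
Qed.

Definition join_map s (x : s + 'I_m) : (s `|` V)%fset :=
  match x with
  | inl w => fincl (fsubsetUl s V) w
  | inr t => fincl (fsubsetUr s V) [` vv_V t]%fset
  end.

Lemma join_map_vertices s (x : s + 'I_m) :
  vertices (join_map x) = sum_fun (@vertices R k s) vv x.
Proof. by case: x. Qed.

Lemma join_map_inj s : C s -> injective (@join_map s).
Proof.
move=> Cs [w|t] [w'|t'] /(congr1 val) /= => [/val_inj ->//|wt|tw|/vv_inj ->//].
  by have := V_notin_C Cs (fsvalP w); rewrite /= wt vv_V.
by have := V_notin_C Cs (fsvalP w'); rewrite /= -tw vv_V.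
Qed.

Lemma join_map_surj s (z : (s `|` V)%fset) : exists x, @join_map s x = z.
Proof.
have := fsvalP z; rewrite in_fsetU => /orP[zs|/imfsetP[/= t _ zt]].
  by exists (inl [` zs]%fset); exact: val_inj.
by exists (inr t); apply: val_inj; rewrite /= zt.
Qed.

Lemma sum_sum_fun (I : finType) (w : I -> E) (b : I + 'I_m -> R) :
  \sum_x b x *: sum_fun w vv x =
  \sum_t b (inl t) *: w t + \sum_t b (inr t) *: vv t.
Proof. by rewrite big_sumType. Qed.

Lemma dpoint_sum_fun (I : finType) (w : I -> E) q (l : I -> nat) (j : 'I_m -> nat) :
  dpoint q (sum_fun w vv) (sum_fun l j) = dpoint q w l + dpoint q vv j.
Proof. by rewrite /dpoint big_sumType /= scalerDr. Qed.

Lemma vproj_dpoint s (l : s -> nat) q : C s -> vproj (dpoint q (@vertices R k s) l) = 0.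
Proof. by move=> Cs; rewrite /dpoint vprojZ vproj_simplex // scaler0. Qed.

Lemma vproj_dpoint_vv (j : 'I_m -> nat) q : vproj (dpoint q vv j) = dpoint q vv j.
Proof. by rewrite /dpoint vprojZ vproj_span. Qed.

Lemma dpoint_vv_inj (j j' : {ffun 'I_m -> 'I_d.+1}) :
  dpoint d%:R^-1 vv (fun t => j t) = dpoint d%:R^-1 vv (fun t => j' t) -> j = j'.
Proof.
have [d0|d0] := posnP d.
  by move=> _; apply/ffunP => t; move: (j t) (j' t); rewrite d0 => x y; rewrite !ord1.
have dN0 : d%:R^-1 != 0 :> R by rewrite invr_eq0 pnatr_eq0 -lt0n.
move=> /(scalerI dN0) /vv_span_inj jj'; apply/ffunP => t; apply/val_inj/eqP.
by rewrite -(eqr_nat R) jj'.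
Qed.

(** Applying [vproj] to an affine relation isolates the coefficients of the [vv t]; what remains is
    an affine relation in C. *)
Lemma join_affine s : maximal_simplex O' s -> affinely_independent (@vertices R k s).
Proof.
move=> /maximal_joinE[s' [Cs' _] ->].
apply: (affine_reparam (join_map_inj Cs') (@join_map_surj s')) => b b1 b0.
have b0' : \sum_w b (inl w) *: vertices w + \sum_t b (inr t) *: vv t = 0.
  by rewrite -sum_sum_fun; apply: etrans b0; apply: eq_bigr => x _; rewrite join_map_vertices.
have br t : b (inr t) = 0.
  apply: (vv_free (y := fun t => b (inr t))).
  have := congr1 vproj b0'; rewrite vprojD vproj_simplex // add0r vproj_span => ->.
  by rewrite /vproj mul0mx.
have bl w : b (inl w) = 0.
  apply: (complex_affine C_complex Cs' (b := fun w => b (inl w))).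
    apply: etrans b1; rewrite big_sumType /= [X in _ + X]big1 ?addr0 //.
  apply: etrans b0'; rewrite [X in _ + X]big1 ?addr0 // => t _.
  by rewrite br scale0r.
by case.
Qed.

(** [vproj] shows that the coordinates at V agree, hence so do the masses u left on C. For u > 0,
    dividing by u reduces the claim to C. *)
Lemma join_face_to_face : face_to_face O'.
Proof.
move=> _ _ /maximal_joinE[s ms ->] /maximal_joinE[s' ms' ->] b b' wb wb' bb' z.
have Cs := proj1 ms; have Cs' := proj1 ms'.
have split1 s1 (b1 : (s1 `|` V)%fset -> R) : C s1 ->
    \sum_w b1 w *: vertices w = \sum_w b1 (join_map (inl w)) *: vertices w +
      \sum_t b1 (join_map (inr t)) *: vv t.
  move=> Cs1; rewrite (big_bij _ _ (join_map_inj Cs1) (@join_map_surj s1)).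
  by rewrite big_sumType.
have mass s1 (b1 : (s1 `|` V)%fset -> R) : C s1 -> is_weight b1 ->
    \sum_w b1 (join_map (inl w)) = 1 - \sum_t b1 (join_map (inr t)).
  move=> Cs1 [_ <-]; rewrite (big_bij _ _ (join_map_inj Cs1) (@join_map_surj s1)).
  by rewrite big_sumType /= addrK.
move: bb'; rewrite !split1 // => bb'.
have br t : b (join_map (inr t)) = b' (join_map (inr t)).
  apply: (vv_span_inj (y := fun t => b (join_map (inr t)))
    (y' := fun t => b' (join_map (inr t)))).
  by have := congr1 vproj bb'; rewrite !vprojD !vproj_simplex // !add0r !vproj_span.
have br' : \sum_t b (join_map (inr t)) = \sum_t b' (join_map (inr t)).
  by apply: eq_bigr => t _.
have bx : \sum_w b (join_map (inl w)) *: vertices w =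
    \sum_w b' (join_map (inl w)) *: vertices w.
  move: bb'; under [X in _ + X = _]eq_bigr do rewrite br.
  by move/addIr.
have extE_join s1 (b1 : (s1 `|` V)%fset -> R) : z \notin V ->
    extE b1 z = extE (fun w => b1 (join_map (inl w))) z.
  move=> zV; have [zs|zs] := boolP (z \in s1).
    rewrite -[z in RHS]/(val [` zs]%fset) extE_in.
    by rewrite -[z]/(val (@join_map s1 (inl [` zs]%fset))) extE_in.
  by rewrite !extE_out // in_fsetU negb_or zs.
have [/imfsetP[/= t _ ->]|zV] := boolP (z \in V).
  have at_t s1 (b1 : (s1 `|` V)%fset -> R) : extE b1 (vv t) = b1 (join_map (inr t)).
    by rewrite -[vv t]/(val (@join_map s1 (inr t))) extE_in.
  by rewrite !at_t br.
rewrite !extE_join //.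
set u := \sum_w b (join_map (inl w)).
have u' : \sum_w b' (join_map (inl w)) = u by rewrite /u !mass // br'.
have u0 : 0 <= u by apply: sumr_ge0 => w _; exact: (proj1 wb).
(* With no mass on C, nonnegativity forces all coordinates there to be 0. *)
have [uE|uN0] := eqVneq u 0.
  have zero s1 (b1 : s1 -> R) : (forall w, 0 <= b1 w) -> \sum_w b1 w = 0 ->
      extE b1 z = 0.
    move=> b10 /psumr_eq0P H; rewrite /extE; case: insubP => // w _ _.
    by apply: H => // w' _.
  rewrite !zero //; try by rewrite ?u'.
    by move=> w; exact: (proj1 wb').
  by move=> w; exact: (proj1 wb).
have extEZ s1 (b1 : s1 -> R) : extE b1 z = u * extE (fun w => u^-1 * b1 w) z.
  rewrite /extE; case: insubP => [w _ _|_]; last by rewrite mulr0.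
  by rewrite mulVKf.
rewrite extEZ [RHS]extEZ; congr (_ * _).
apply: (complex_face_to_face C_complex ms ms').
- split=> [w|]; first by rewrite mulr_ge0 ?invr_ge0 //; exact: (proj1 wb).
  by rewrite -mulr_sumr mulVf.
- split=> [w|]; first by rewrite mulr_ge0 ?invr_ge0 //; exact: (proj1 wb').
  by rewrite -mulr_sumr u' mulVf.
under eq_bigr do rewrite -scalerA.
under [RHS]eq_bigr do rewrite -scalerA.
by rewrite -!scaler_sumr bx.
Qed.

(** Gives the vertices of a maximal simplex as a disjoint union, the shape in which [bform_split]
    applies. *)
Lemma bb_space_join c : bb_space O' r d c <->
  exists2 g : E -> R, Cr_function r g & forall s, maximal_simplex C s ->
    forall b : s + 'I_m -> R, is_weight b ->
    g (\sum_w b (inl w) *: vertices w + \sum_t b (inr t) *: vv t) =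
    bform d d (fun l => c (dpoint d%:R^-1 (sum_fun (@vertices R k s) vv) l)) b.
Proof.
have vE s : (fun x => vertices (@join_map s x)) = sum_fun (@vertices R k s) vv.
  by apply/funext => x; exact: join_map_vertices.
split=> -[g Cg gP]; exists g => //.
  move=> s ms b wb.
  have := (simplex_reparam (join_map_inj (proj1 ms)) (@join_map_surj s) _ _ _ _ _).1
    (gP _ (maximal_join ms)) b wb.
  by rewrite vE -sum_sum_fun -vE.
move=> _ /maximal_joinE[s ms ->].
apply/(simplex_reparam (join_map_inj (proj1 ms)) (@join_map_surj s)) => b wb.
have := gP s ms b wb; rewrite -sum_sum_fun -vE => <-.
by [].
Qed.

Let mult (j : {ffun 'I_m -> 'I_d.+1}) : R :=
  (d`!)%:R / (((d - \sum_t j t)`!)%:R * (\prod_t (j t)`!)%:R).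

Lemma mult_neq0 j : mult j != 0.
Proof.
rewrite /mult mulf_neq0 ?invr_eq0 ?mulf_neq0 // pnatr_eq0 -lt0n ?fact_gt0 //.
by rewrite prodn_gt0 // => t; exact: fact_gt0.
Qed.

(** The slice of [j0] is a linear combination of homogenised values of g over a grid of points y,
    and x enters each of them through an affine substitution only. *)
Lemma join_restrict c (j0 : {ffun 'I_m -> 'I_d.+1}) : (\sum_t j0 t <= d)%N ->
  bb_space O' r d c ->
  form_space C r d (d - \sum_t j0 t) d%:R^-1
    (fun p => c (p + dpoint d%:R^-1 vv (fun t => j0 t))).
Proof.
move=> j0d /bb_space_join[g Cg gP].
have [lam lamP] := grid_dual (R := R) j0.
pose rho (y : {ffun 'I_m -> 'I_d.+1}) : R := 1 + \sum_t (y t).+1%:R.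
have rho0 y : 0 < rho y by apply: ltr_pwDl => //; apply: sumr_ge0 => t _; exact: ler0n.
pose sv (y : {ffun 'I_m -> 'I_d.+1}) : E := \sum_t (y t).+1%:R *: vv t.
exists (fun x => (mult j0)^-1 * \sum_y lam y *
    (rho y ^+ d * g ((rho y)^-1 *: (x + sv y)))).
  apply: Cr_scale; apply: Cr_sum => y _; apply: Cr_scale; apply: Cr_scale.
  apply: Cr_ext (Cr_diag_affine (const_mx (rho y)^-1) ((rho y)^-1 *: sv y) Cg) => x.
  by congr g; rewrite scalerDr; congr (_ + _); apply/rowP => u; rewrite !mxE.
move=> s ms b wb; set x := \sum_w b w *: vertices w.
pose A (l : s + 'I_m -> nat) := c (dpoint d%:R^-1 (sum_fun (@vertices R k s) vv) l).
have ptE y : rho y ^+ d * g ((rho y)^-1 *: (x + sv y)) =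
    bform d d A (sum_fun b (fun t => (y t).+1%:R)).
  (* The weights [b] together with the grid values have total mass [rho y]; dividing by it brings
     the point back into the simplex. *)
  pose b1 z := (rho y)^-1 * sum_fun b (fun t => (y t).+1%:R) z.
  have wb1 : is_weight b1.
    split=> [z|].
      apply: mulr_ge0; first by rewrite invr_ge0 ltW.
      case: z => [w|t] /=; last exact: ler0n.
      exact: (proj1 wb).
    by rewrite -mulr_sumr big_sumType /= (proj2 wb) mulVf // gt_eqF.
  have := gP s ms b1 wb1; rewrite /b1 /= bform_scale.
  have -> : \sum_w ((rho y)^-1 * b w) *: vertices w +
      \sum_t ((rho y)^-1 * (y t).+1%:R) *: vv t = (rho y)^-1 *: (x + sv y).
    rewrite scalerDr /x /sv !scaler_sumr; congr (_ + _); apply: eq_bigr => z _;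
    by rewrite scalerA.
  by move=> ->; rewrite mulrA -exprMn mulfV ?gt_eqF // expr1n mul1r.
suff -> : \sum_y lam y * (rho y ^+ d * g ((rho y)^-1 *: (x + sv y))) =
    mult j0 * bform d (d - \sum_t j0 t) (fun l => A (sum_fun l (fun t => j0 t))) b.
  rewrite mulrA mulVf ?mult_neq0 // mul1r.
  by apply: bform_ext => l _; rewrite /A dpoint_sum_fun.
(* After the splitting, y enters only through the monomials y^j, and [lam] keeps just j = j0. *)
transitivity (\sum_y \sum_(j : {ffun 'I_m -> 'I_d.+1} | (\sum_t j t <= d)%N)
    (mult j * bform d (d - \sum_t j t) (fun l => A (sum_fun l (fun t => j t))) b) *
    (lam y * \prod_t (y t).+1%:R ^+ j t)).
  apply: eq_bigr => y _; rewrite ptE bform_split mulr_sumr; apply: eq_bigr => j _ /=.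
  by rewrite -/(mult j); ring.
rewrite exchange_big /= (bigD1 j0) //= [X in _ + X = _]big1 => [|j /andP[_ jj0]].
  by rewrite addr0 -mulr_sumr lamP eqxx mulr1.
by rewrite -mulr_sumr lamP (negPf jj0) mulr0.
Qed.

(** Projection followed by a right inverse of the matrix of the [vv t]; the coordinates y thus
    become linear functions on all of R^k. *)
Lemma barycentric_coord : exists Y : 'M[R]_(k, m), forall (x : E) (y : 'I_m -> R),
  vproj x = 0 -> forall t, ((x + \sum_t y t *: vv t) *m Y) 0 t = y t.
Proof.
pose Vm : 'M[R]_(m, k) := \matrix_t vv t.
have mulV (y : 'rV[R]_m) : y *m Vm = \sum_t y 0 t *: vv t.
  by rewrite mulmx_sum_row; apply: eq_bigr => t _; rewrite rowK.
have freeV : row_free Vm.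
  apply: inj_row_free => y; rewrite mulV => /vv_free y0.
  by apply/rowP => t; rewrite mxE y0.
exists (D *m pinvmx Vm) => x y x0 t.
rewrite mulmxA -/(vproj _) vprojD x0 add0r vproj_span.
rewrite (_ : \sum_t y t *: vv t = (\row_t y t) *m Vm).
  by rewrite -mulmxA mulmxVp // mulmx1 mxE.
by rewrite mulV; apply: eq_bigr => u _; rewrite mxE.
Qed.

(** The coefficients placed on the join have the single nonzero slice [j0]: [vproj] sends a domain
    point to its component in the span of the [vv t], which determines its multi-index. *)
Lemma join_extend c (j0 : {ffun 'I_m -> 'I_d.+1}) : (\sum_t j0 t <= d)%N ->
  form_space C r d (d - \sum_t j0 t) d%:R^-1 c ->
  bb_space O' r d (fun z => if vproj z == dpoint d%:R^-1 vv (fun t => j0 t)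
                            then c (z - dpoint d%:R^-1 vv (fun t => j0 t)) else 0).
Proof.
move=> j0d [g Cg gP]; set n := (d - _)%N in gP *.
have [Y YP] := barycentric_coord.
have [mu muP] := poly_interpolation (R := R) d.
pose yc t (z : E) := (z *m Y) 0 t.
pose uc z := 1 - \sum_t yc t z.
have Cyc t : Cr_function r (yc t).
  have Hc : Cr_function r (fun z : E => \sum_u Y u t * z 0 u).
    by apply: Cr_sum => u _; apply: Cr_scale; exact: Cr_coord.
  by apply: Cr_ext Hc => z; rewrite /yc mxE; apply: eq_bigr => u _; rewrite mulrC.
have Cuc : Cr_function r uc.
  have Hc := Cr_add (Cr_cst (k := k) r 1) (Cr_scale (-1) (Cr_sum (index_enum 'I_m)
    (P := xpredT) (fun t _ => Cyc t))).
  by apply: Cr_ext Hc => z; rewrite /uc mulN1r.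
apply/bb_space_join.
(* The term of [j0] in [bform_split], with its form on C at mass u = 1 - |y| replaced by the
   interpolation formula of [star_form_interpolation]. *)
exists (fun z => mult j0 * (\prod_t yc t z ^+ j0 t * \sum_(a < d.+1)
   (\sum_(p < d.+1) mu p a * uc z ^+ p) *
   (a.+1%:R ^+ n * g (a.+1%:R^-1 *: (z - vproj z))))).
  apply: Cr_scale; apply: Cr_mul.
    by apply: Cr_prod => t; exact: Cr_exp.
  apply: Cr_sum => a _; apply: Cr_mul.
    by apply: Cr_sum => p _; apply: Cr_scale; exact: Cr_exp.
  apply: Cr_scale.
  (* The map z to (z - vproj z) / (a + 1) acts coordinatewise. *)
  have Hc := Cr_diag_affine (\row_u (a.+1%:R^-1 * (1 - (i <= u)%N%:R))) 0 Cg.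
  apply: Cr_ext Hc => z; congr g.
  have -> : z - vproj z = \row_u ((1 - (i <= u)%N%:R) * z 0 u).
    apply/rowP => u; rewrite mxE [RHS]mxE [(- vproj z) 0 u]mxE vprojE.
    by rewrite mulrBl mul1r [_%:R * _]mulrC.
  by rewrite addr0; apply/rowP => u; rewrite !mxE mulrA.
move=> s ms b wb; have Cs := proj1 ms.
set x := \sum_w b (inl w) *: vertices w; set y := \sum_t _.
have px : vproj x = 0 by exact: vproj_simplex.
have ycE t : yc t (x + y) = b (inr t) by rewrite /yc YP.
have ucE : uc (x + y) = \sum_w b (inl w).
  rewrite /uc (eq_bigr (fun t => b (inr t))); last by move=> t _; rewrite ycE.
  by rewrite -(proj2 wb) big_sumType /= addrK.
have piE : x + y - vproj (x + y) = x by rewrite vprojD px add0r vproj_span addrK.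
(* All slices other than [j0] have zero coefficients. *)
rewrite piE ucE bform_split [RHS](bigD1 j0) //= [X in _ = _ + X]big1 => [|j /andP[_ jj0]]; last first.
  rewrite [bform _ _ _ _](_ : _ = 0) ?mulr0 //.
  rewrite /bform big1 // => l _; rewrite dpoint_sum_fun vprojD vproj_dpoint // add0r.
  rewrite vproj_dpoint_vv; case: eqP => [/dpoint_vv_inj jE|_]; last by rewrite mul0r.
  by rewrite jE eqxx in jj0.
rewrite addr0 -/n -/(mult j0) -[RHS]mulrA; congr (_ * _).
under eq_bigr do rewrite ycE.
congr (_ * _).
have s0 := C_star ms.
rewrite (star_form_interpolation (w := @vertices R k s) (t0 := [` s0]%fset) (g := g) _ _ muP).
- by [].
- exact: leq_subr.
- by [].
- move=> b1 wb1; rewrite gP //; apply: bform_ext => l _.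
  rewrite dpoint_sum_fun vprojD vproj_dpoint // add0r vproj_dpoint_vv eqxx.
  by rewrite addrK.
- by move=> w; exact: (proj1 wb).
have := proj2 wb; rewrite big_sumType /= => <-; rewrite lerDl.
by apply: sumr_ge0 => t _; exact: (proj1 wb).
Qed.

Lemma join_domain_points s (l : s -> nat) (j : 'I_m -> nat) : maximal_simplex C s ->
  (\sum_t l t + \sum_t j t)%N = d ->
  domain_points O' d (dpoint d%:R^-1 (@vertices R k s) l + dpoint d%:R^-1 vv j).
Proof.
move=> ms slj; have Cs := proj1 ms.
have injh := join_map_inj Cs; have surjh := @join_map_surj s.
pose L : (s `|` V)%fset -> nat := extend 0%N (@join_map s) (sum_fun l j).
have sL : (\sum_z L z)%N = d.
  rewrite (big_bij _ _ injh surjh) -[RHS]slj big_sumType.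
  by congr addn; apply: eq_bigr => t _; rewrite /L extendE.
pose L' : {ffun (s `|` V)%fset -> 'I_d.+1} := [ffun z => inord (L z)].
have L'E : (fun z => nat_of_ord (L' z)) = L.
  apply/funext => z; rewrite ffunE inordK // ltnS -[X in (_ <= X)%N]sL.
  exact: leq_sum_entry.
have -> : dpoint d%:R^-1 (@vertices R k s) l + dpoint d%:R^-1 vv j =
    dpoint d%:R^-1 (@vertices R k (s `|` V)%fset) (fun z => L' z).
  rewrite L'E /L dpoint_extend // -dpoint_sum_fun.
  by congr dpoint; apply/funext => x; rewrite join_map_vertices.
apply: maximal_domain_points; first exact: (proj1 (maximal_join ms)).
by rewrite -[RHS]sL; apply: eq_bigr => z _; rewrite -L'E.
Qed.

Lemma join_domain_pointsE p : domain_points O' d p ->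
  exists2 s, maximal_simplex C s & exists (l : s -> nat) (j : {ffun 'I_m -> 'I_d.+1}),
    (\sum_t l t + \sum_t j t)%N = d /\
    p = dpoint d%:R^-1 (@vertices R k s) l + dpoint d%:R^-1 vv (fun t => j t).
Proof.
move=> /(domain_points_maximal join_finite)[_ /maximal_joinE[s ms ->] [L sL ->]].
have Cs := proj1 ms; exists s => //.
have injh := join_map_inj Cs; have surjh := @join_map_surj s.
exists (fun w => L (join_map (inl w))), [ffun t => L (join_map (inr t))]; split.
  rewrite -[RHS]sL [RHS](big_bij _ _ injh surjh) big_sumType /=.
  by congr addn; apply: eq_bigr => t _; rewrite ffunE.
rewrite -dpoint_sum_fun /dpoint (big_bij _ _ injh surjh); congr (_ *: _).
apply: eq_bigr => -[w|t] _ /=; first by [].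
by rewrite ffunE.
Qed.

(** * The minimal determining set of the join and its dual family *)

Section minimal_sets.
Variable M : nat -> set E.
Hypothesis M_min : forall j, (j <= d)%N -> minimal_determining_set j
  (spline_space (scale_complex (j%:R / d%:R) C) r j) (M j).

(** The indices at v_1, ..., v_m only; the index at O is the remaining d minus their total. *)
Definition join_index := {j : {ffun 'I_m -> 'I_d.+1} | (\sum_t j t <= d)%N}.

Definition join_fibre (j : join_index) : finType :=
  fset_set (M (d - \sum_t val j t)).

(** A dependent pair keeps the contributions of different multi-indices disjoint, so its cardinality
    is a plain sum. *)
Definition join_set_index := {j : join_index & join_fibre j}.

Definition join_point (x : join_set_index) : E :=
  val (tagged x) + dpoint d%:R^-1 vv (fun t => val (tag x) t).

Let M_sub j p : (j <= d)%N -> M j p ->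
  domain_points (scale_complex (j%:R / d%:R) C) j p.
Proof. by move=> jd; have [[Msub _] _] := M_min jd; exact: Msub. Qed.

Let M_fin j : (j <= d)%N -> finite_set (M j).
Proof.
move=> jd; apply: sub_finite_set (domain_points_finite j (scale_finite C_complex _)).
by move=> p; exact: M_sub.
Qed.

Let M_fibre (j : join_index) (p : E) :
  p \in fset_set (M (d - \sum_t val j t)) -> M (d - \sum_t val j t) p.
Proof.
rewrite in_fset_set; first exact: set_mem.
by apply: M_fin; exact: leq_subr.
Qed.

Let O'_ne s : maximal_simplex O' s -> s != fset0.
Proof. by move=> [[]]. Qed.

(** Each slice of an admissible c is admissible for some C_j. If c vanishes on M', the slice
    vanishes on M_j, hence at all domain points of C_j. *)
Lemma join_set_determining :
  determining_set d (spline_space O' r d) (range join_point).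
Proof.
apply/(determining_bb r d join_finite O'_ne join_affine); split.
  move=> _ [[j p] _ <-]; rewrite /join_point /=.
  have jd := leq_subr (\sum_t val j t)%N d.
  have Mp := M_fibre (fsvalP p).
  have [s ms [l sl ->]] := scale_domain_pointsE C_complex jd (M_sub jd Mp).
  by apply: join_domain_points ms _; rewrite sl subnK //; exact: (valP j).
move=> c cW c0 _ /join_domain_pointsE[s ms [l [j [slj ->]]]].
have jd : (\sum_t j t <= d)%N by rewrite -[X in (_ <= X)%N]slj leq_addl.
have nd := leq_subr (\sum_t j t)%N d.
have sl : (\sum_t l t)%N = (d - \sum_t j t)%N 
  by apply/eqP; rewrite -(eqn_add2r (\sum_t j t)%N) subnK // slj.
have /(form_space_scale C r _ nd) cjW := join_restrict jd cW.
have [Mdet _] := M_min nd.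
have [_ Mdet'] := (determining_bb r _ (scale_finite C_complex _)
  (@scale_nonempty _ _ _ C_complex _) (@scale_affine _ _ _ C_complex _) _).1 Mdet.
apply: (Mdet' _ cjW); last exact: scale_domain_points nd (proj1 ms) sl.
move=> p Mp.
have pM : p \in fset_set (M (d - \sum_t j t)) by rewrite in_fset_set; [exact: mem_set|exact: M_fin].
apply: c0; exists (Tagged join_fibre (i := exist _ j jd : join_index) [` pM]%fset) => //.
Qed.

(** The dual function of p in M_j is placed on one slice and extended by 0 to the others. *)
Lemma join_set_dual : exists2 cf : join_set_index -> E -> R,
  forall x, bb_space O' r d (cf x) & forall x x', cf x (join_point x') = (x == x')%:R.
Proof.
suff /choice[cf cfP] x : exists c, bb_space O' r d c /\
    forall x', c (join_point x') = (x == x')%:R.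
  by exists cf => x; [have [] := cfP x|have [_] := cfP x].
case: x => j p.
have jd := leq_subr (\sum_t val j t)%N d.
have Mp := M_fibre (fsvalP p).
have [c [cW cp c0]] := minimal_dual (scale_finite C_complex _)
  (@scale_nonempty _ _ _ C_complex _) (@scale_affine _ _ _ C_complex _) (M_min jd) Mp.
have cE := join_extend (valP j) ((form_space_scale C r c jd).1 cW).
eexists; split; first exact: cE.
move=> [j' p']; rewrite /join_point /=.
have j'd := leq_subr (\sum_t val j' t)%N d.
have Mp' := M_fibre (fsvalP p').
have [s ms [l _ pE]] := scale_domain_pointsE C_complex j'd (M_sub j'd Mp').
rewrite vprojD vproj_dpoint_vv [vproj (val p')](_ : _ = 0) ?add0r; last first.
  by rewrite /= pE vproj_dpoint //; exact: (proj1 ms).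
(* Equal components along the [vv t] mean the same slice, where duality in M_j decides; on any other
   slice the value is 0. *)
case: (_ =P dpoint _ _ (fun t => val j t)) => [/dpoint_vv_inj /val_inj jj'|jj'].
  subst j'; rewrite addrK; case: eqP => [xx'|xx'].
    have /= pp' := congr1 (fun x : join_set_index => val (tagged x)) xx'.
    by rewrite -pp' cp.
  by rewrite c0 //= => /val_inj pp'; apply: xx'; rewrite pp'.
case: eqP => // xx'; case: jj'.
by have := congr1 (fun x : join_set_index => val (tag x)) xx' => /= ->.
Qed.

Lemma join_set_minimal :
  minimal_determining_set d (spline_space O' r d) (range join_point).
Proof.
have [cf cfW cfe] := join_set_dual.
apply: (dual_minimal join_finite O'_ne join_affine cfW cfe join_set_determining).
Qed.

Lemma join_has_dim : has_dim (spline_space O' r d) #|{: join_set_index}|.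
Proof.
have [cf cfW cfe] := join_set_dual.
apply: (dual_has_dim join_finite O'_ne join_affine cfW cfe join_set_determining).
move=> f [_ fpoly]; apply: BB_coefficients_exist => //; first exact: join_face_to_face.
by move=> _ _ /maximal_joinE[s ms ->]; rewrite in_fsetU C_star.
Qed.

End minimal_sets.

End join.

(** * Counting the multi-indices and the points of M' *)

Section index_count.

(** The entries are at most n, so the bound d can be lowered to n, which gives the known count of
    ordered partitions. *)
Lemma card_bounded_multi_index (m d n : nat) : (n <= d)%N ->
  #|[set j : {ffun 'I_m.+1 -> 'I_d.+1} | (\sum_t j t)%N == n]%SET| = 'C(m + n, m).
Proof.
move=> nd; rewrite -card_ord_partitions.
pose f (t : m.+1.-tuple 'I_n.+1) : {ffun 'I_m.+1 -> 'I_d.+1} :=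
  [ffun u => widen_ord (nd : (n.+1 <= d.+1)%N) (tnth t u)].
have injf : injective f.
  move=> t t' /ffunP tt'; apply: eq_from_tnth => u; apply: val_inj.
  by have := congr1 val (tt' u); rewrite !ffunE.
rewrite -(card_imset _ injf); apply: eq_card => j; rewrite inE.
apply/idP/imsetP => [/eqP sj|[t]]; last first.
  rewrite inE big_tuple => /eqP st ->; apply/eqP; rewrite -[RHS]st.
  by apply: eq_bigr => u _; rewrite ffunE.
have jn u : (j u < n.+1)%N.
  by rewrite ltnS -sj (leq_sum_entry (fun t => nat_of_ord (j t))).
exists [tuple inord (j u) | u < m.+1]; last first.
  by apply/ffunP => u; apply: val_inj; rewrite ffunE /= tnth_mktuple inordK.
rewrite inE big_tuple; apply/eqP; rewrite -[RHS]sj; apply: eq_bigr => u _.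
by rewrite tnth_mktuple inordK.
Qed.

Lemma card_multi_index_binz (i k d j : nat) : (i <= k)%N -> (j <= d)%N ->
  #|[set l : {ffun 'I_(k - i) -> 'I_d.+1} | (\sum_t l t)%N == (d - j)%N]%SET| =
  binz (d%:Z + k%:Z - j%:Z - i%:Z - 1) (k%:Z - i%:Z - 1).
Proof.
move=> ik jd; have -> : d%:Z + k%:Z - j%:Z - i%:Z - 1 = (d - j)%N%:Z + (k - i)%N%:Z - 1.
  by rewrite -!subzn //; ring.
(* For k = i there is only the empty multi-index, of total 0: one if j = d and none otherwise, as in
   the convention for lower index -1. *)
rewrite subzn //; case: (k - i)%N => [|m].
  rewrite addr0 sub0r; case: (d - j)%N => [|n] /=.
    rewrite (_ : [set _ | _]%SET = [set: _]%SET) ?cardsT ?card_ffun ?card_ord //.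
    by apply/finset.setP => l; rewrite !inE big_ord0.
  rewrite (_ : [set _ | _]%SET = finset.set0) ?cards0 //.
  by apply/finset.setP => l; rewrite !inE big_ord0.
rewrite card_bounded_multi_index ?leq_subr //.
have -> : (d - j)%N%:Z + m.+1%:Z - 1 = (m + (d - j))%N%:Z.
  by rewrite -addn1 !PoszD; ring.
by have -> : m.+1%:Z - 1 = m%:Z by rewrite -addn1 PoszD; ring.
Qed.

Lemma card_join_set_index (R : realType) (k m d : nat) (M : nat -> set 'rV[R]_k) :
  #|{: @join_set_index R k d m M}| =
  (\sum_(0 <= j < d.+1)
    #|[set l : {ffun 'I_m -> 'I_d.+1} | (\sum_t l t)%N == (d - j)%N]%SET| *
    #|` fset_set (M j)|)%N.
Proof.
rewrite card_tagged sumnE big_map big_enum /=.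
transitivity (\sum_(l : {ffun 'I_m -> 'I_d.+1} | (\sum_t l t <= d)%N)
    #|` fset_set (M (d - \sum_t l t)%N)|)%N.
  rewrite [RHS](reindex_omap (fun x : join_index d m => val x) insub) /=; last first.
    by move=> l ld; rewrite insubT.
  apply: eq_big => [x|x _]; last by rewrite cardfE.
  by rewrite valK eqxx andbT; have := valP x; rewrite /= => ->.
(* The multi-indices are grouped by the index d - |l| at O, which is the degree j. *)
rewrite (partition_big (fun l : {ffun 'I_m -> 'I_d.+1} => inord (d - \sum_t l t) : 'I_d.+1)
  xpredT) //= big_mkord.
apply: eq_bigr => j _.
rewrite -sum1_card big_distrl /=; apply: eq_big => l; last first.
  by move=> /andP[ld /eqP <-]; rewrite mul1n inordK // ltnS leq_subr.
rewrite !inE -val_eqE /= inordK ?ltnS ?leq_subr //.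
apply/andP/eqP => [[ld /eqP <-]|sl]; first by rewrite subKn.
have jd : (j <= d)%N by rewrite -ltnS.
by rewrite sl leq_subr subKn.
Qed.

End index_count.

(** * The union over j and the dimension formula *)

Theorem theorem5p2 (R : realType) (i k r d : nat)
  (C : set {fset 'rV[R]_k}) (v : 'I_(k - i).+1 -> 'rV[R]_k)
  (M : nat -> set 'rV[R]_k)
  (hik : (i <= k)%N) (hrd : (r <= d)%N)
  (C_complex : simplicial_complex C) (C_dim : complex_dim C i)
  (C_sub : polyhedron C `<=`
     [set x : 'rV[R]_k | forall t : 'I_k, (i <= t)%N -> x 0 t = 0])
  (C_star : star_of_origin
              [set x : 'rV[R]_k | forall t : 'I_k, (i <= t)%N -> x 0 t = 0] C)
  (v0 : v ord0 = 0) (v_affine : affinely_independent v)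
  (v_sub : conv_hull v `<=`
     [set x : 'rV[R]_k | forall t : 'I_k, (t < i)%N -> x 0 t = 0])
  (M_min : forall j : nat, (j <= d)%N ->
     minimal_determining_set j
       (spline_space (scale_complex (j%:R / d%:R) C) r j) (M j)) :
  let O' := join_complex C [fset v (lift ord0 t) | t in 'I_(k - i)]%fset in
  minimal_determining_set d (spline_space O' r d)
    (\bigcup_(j < d.+1)
       [set p + domain_point v l | p in M j &
          l in [set l : {ffun 'I_(k - i).+1 -> 'I_d.+1} |
                 multi_index _ d l /\ l ord0 = j :> nat]]) /\
  has_dim (spline_space O' r d)
    (\sum_(0 <= j < d.+1)
       binz (d%:Z + k%:Z - j%:Z - i%:Z - 1) (k%:Z - i%:Z - 1)
         * #|` fset_set (M j)|)%N.
Proof.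
move=> O'; set vv := fun t : 'I_(k - i) => v (lift ord0 t).
have delta_weight (I : finType) (x : I) : is_weight (fun t => (t == x)%:R : R).
  split=> [t|]; first exact: ler0n.
  by rewrite (bigD1 x) //= eqxx big1 ?addr0 // => t /negPf ->.
have delta_hull (I : finType) (w : I -> 'rV[R]_k) x : conv_hull w (w x).
  exists (fun t => (t == x)%:R) => //.
  by rewrite (bigD1 x) //= eqxx scale1r big1 ?addr0 // => t /negPf ->; rewrite scale0r.
have C_sub' s : C s -> forall w, w \in s -> forall t : 'I_k, (i <= t)%N -> w 0 t = 0.
  move=> Cs w ws; apply: C_sub; exists s => //.
  exact: (delta_hull _ (@vertices R k s) [` ws]%fset).
have C0 := proj1 C_star.
have vv_free (y : 'I_(k - i) -> R) : \sum_t y t *: vv t = 0 -> forall t, y t = 0.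
  move=> y0 t.
  (* A linear relation among the other vertices becomes an affine one by putting minus its total at
     v_0 = 0. *)
  pose b u := if unlift ord0 u is Some t then y t else - \sum_t y t.
  have bl u : b (lift ord0 u) = y u by rewrite /b liftK.
  have b0 : b ord0 = - \sum_t y t by rewrite /b unlift_none.
  rewrite -bl; apply: v_affine.
    rewrite big_ord_recl b0 [X in _ + X](eq_bigr y) ?addNr // => u _.
  rewrite big_ord_recl v0 scaler0 add0r; apply: etrans y0.
  by apply: eq_bigr => u _; rewrite bl.
have vv_sub u (t : 'I_k) : (t < i)%N -> vv u 0 t = 0.
  by apply: v_sub; exact: delta_hull.
have dpE (l : {ffun 'I_(k - i).+1 -> 'I_d.+1}) :
    domain_point v l = dpoint d%:R^-1 vv (fun t => l (lift ord0 t)).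
  by rewrite /domain_point /dpoint big_ord_recl v0 scaler0 add0r.
(* The degree j and the multi-index l with entry j at O correspond to the entries of l at the other
   vertices. *)
have -> : \bigcup_(j < d.+1)
       [set p + domain_point v l | p in M j &
          l in [set l : {ffun 'I_(k - i).+1 -> 'I_d.+1} |
                 multi_index _ d l /\ l ord0 = j :> nat]] =
    range (@join_point R k d (k - i) vv M).
  have M_fin j : (j <= d)%N -> finite_set (M j).
    move=> jd; have [[MD _] _] := M_min j jd.
    exact: sub_finite_set MD (domain_points_finite j (scale_finite C_complex _)).
  apply/seteqP; split=> [_ [j jd [p Mp [l [/eqP sl lj] <-]]]|_ [[jf p] _ <-]].
    pose jf : {ffun 'I_(k - i) -> 'I_d.+1} := [ffun t => l (lift ord0 t)].
    have sjf : (\sum_t jf t)%N = (d - j)%N.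
      rewrite -[in RHS]sl -lj big_ord_recl addKn; apply: eq_bigr => t _.
      by rewrite ffunE.
    have jfd : (\sum_t jf t <= d)%N by rewrite sjf leq_subr.
    have {}jd : (j <= d)%N := jd.
    have pM : p \in fset_set (M (d - \sum_t jf t)%N).
      by rewrite sjf subKn // in_fset_set; [exact: mem_set|exact: M_fin].
    exists (Tagged (@join_fibre R k d (k - i) M)
      (i := exist _ jf jfd : join_index d (k - i)) [` pM]%fset) => //.
    rewrite /join_point /= dpE; congr (_ + dpoint _ _ _).
    by apply/funext => t; rewrite ffunE.
  have nd := leq_subr (\sum_t val jf t)%N d.
  exists (d - \sum_t val jf t)%N; first by rewrite /= ltnS.
  exists (val p).
    have := fsvalP p; rewrite in_fset_set; [exact: set_mem|exact: M_fin].
  (* The entry at O is restored as d minus the total of the others. *)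
  pose l : {ffun 'I_(k - i).+1 -> 'I_d.+1} :=
    [ffun u => if unlift ord0 u is Some t then val jf t
               else inord (d - \sum_t val jf t)].
  have l0 : l ord0 = (d - \sum_t val jf t)%N :> nat.
    by rewrite ffunE unlift_none inordK // ltnS.
  have ll t : l (lift ord0 t) = val jf t by rewrite ffunE liftK.
  exists l; last first.
    by rewrite dpE; congr (_ + dpoint _ _ _); apply/funext => t; rewrite ll.
  split=> //; rewrite /multi_index big_ord_recl l0.
  rewrite [X in (_ + X)%N](eq_bigr (fun t => nat_of_ord (val jf t))); last by move=> t _; rewrite ll.
  by rewrite subnK //; exact: (valP jf).
split; first exact: (join_set_minimal C_complex C_sub' C0 vv_free vv_sub M_min).
have := join_has_dim C_complex C_sub' C0 vv_free vv_sub M_min.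
rewrite card_join_set_index; congr has_dim; rewrite !big_mkord; apply: eq_bigr => j _.
by rewrite card_multi_index_binz // -ltnS.
Qed.
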